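(* Consider the DEEP-FRI protocol (described in the context) with $r$ rounds, $n=|L^{(0)}|$, degree bound $d^{(0)} = 3 \cdot 2^{r}-2$ and $\mathsf{RS}^{(0)} = \mathsf{RS}[\mathbb{F}_q, L^{(0)}, d^{(0)}]$. For some $\epsilon, \delta > 0$ let $\delta^* = \delta - 2r\epsilon$, $\mathcal{L}^* = \mathcal{L}(\mathbb{F}_q, L^{(0)}, d^{(0)}, \delta^* )$ and $\nu^* = 2\mathcal{L}^*\left(\frac{d^{(0)}}{q}+\epsilon\right)^{1/3}+\frac{4}{\epsilon^2 q}$. Then, when the protocol is invoked on an oracle $f^{(0)}:L^{(0)}\to\mathbb{F}_q$: (1) (Prover complexity) the honest prover uses $O(n)$ arithmetic operations over $\mathbb{F}_q$; (2) (Verifier complexity) a single invocation of the QUERY phase uses $O(\log n)$ arithmetic operations over $\mathbb{F}_q$, and this also bounds the communication and query complexity (in field elements); (3) (Completeness) if $f^{(0)}\in\mathsf{RS}^{(0)}$ and $f^{(1)},\ldots,f^{(r)}$ are computed by the honest prover, the verifier accepts with probability $1$; (4) (Soundness) if $\Delta(f^{(0)},\mathsf{RS}^{(0)}) > \delta$, then except with probability $\mathrm{err}_{\mathrm{COMMIT}} \leq r\cdot \nu^* \leq (\log n) \cdot \nu^*$ over the verifier's randomness in the COMMIT phase, for any (adaptively chosen) prover messages $B^{(i)}_{z^{(i)}}$, $f^{(1)},\ldots, f^{(r)}$, $C$, the QUERY phase with repetition parameter $\ell$ accepts with probability at most $\mathrm{err}_{\mathrm{QUERY}} \leq \left(1-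 \delta^* + (\log n) \cdot \epsilon \right)^\ell$. Consequently the soundness error is at most $(\log n) \cdot \nu^* +\left(1- \delta^* + (\log n) \cdot \epsilon \right)^\ell$.
   Context: Setting: $\mathbb{F}_q$ is a field of characteristic $2$. $L^{(0)},\dots,L^{(r)}\subseteq\mathbb{F}_q$ are $\mathbb{F}_2$-linear subspaces with $\dim L^{(i)}=k-i$ ($n=2^k$); for each $i$, $L^{(i)}_0\subseteq L^{(i)}$ is a 1-dimensional $\mathbb{F}_2$-subspace, $q^{(i)}(X)=\prod_{a\in L^{(i)}_0}(X-a)$, and $L^{(i+1)}=q^{(i)}(L^{(i)})$. Hash: for $f:L^{(i)}\to\mathbb{F}_q$ and $x\in\mathbb{F}_q$, $H_x[f]:L^{(i+1)}\to\mathbb{F}_q$ is defined by: for $s\in L^{(i+1)}$ with $s_0,s_1\in L^{(i)}$ the two roots of $q^{(i)}(X)-s$, let $P_{f,s}$ be the unique polynomial of degree $\le1$ with $P_{f,s}(s_j)=f(s_j)$, and $H_x[f](s)=P_{f,s}(x)$. $\mathsf{QUOTIENT}(g,z,b)(y)=(g(y)-b)/(y-z)$. $\mathsf{RS}[\mathbb{F}_q,L,d]$ is the set of $f:L\to\mathbb{F}_q$ whose interpolating polynomial has degree $<d$. $\Delta$ is relative Hamming distance. $\mathcal{L}(\mathbb{F}_q,D,d,\delta)$ is the maximum over $u:D\to\mathbb{F}_q$ of the number of $v\in\mathsf{RS}[\mathbb{F}_q,D,d]$ with $\Delta(u,v)<\delta$. Protocol DEEP-FRI on input $f^{(0)}:L^{(0)}\to\mathbb{F}_q$.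 COMMIT: for $i=0,\dots,r-1$: the verifier sends uniform $z^{(i)}\in\mathbb{F}_q$; the prover sends a degree-$\le1$ polynomial $B^{(i)}_{z^{(i)}}(X)$ (honestly, $B^{(i)}_{z^{(i)}}(x)$ is the value at $z^{(i)}$ of the interpolating polynomial of $H_x[f^{(i)}]$); the verifier sends uniform $x^{(i)}\in\mathbb{F}_q$; the prover writes an oracle $f^{(i+1)}:L^{(i+1)}\to\mathbb{F}_q$ (honestly, $\mathsf{QUOTIENT}(H_{x^{(i)}}[f^{(i)}],z^{(i)},B^{(i)}_{z^{(i)}}(x^{(i)}))$). Finally the prover sends $C\in\mathbb{F}_q$ (honestly the constant value of $f^{(r)}$). QUERY, repeated $\ell$ times: the verifier picks uniform $s^{(0)}\in L^{(0)}$; for $i=0,\dots,r-1$ sets $s^{(i+1)}=q^{(i)}(s^{(i)})$, computes $H_{x^{(i)}}[f^{(i)}](s^{(i+1)})$ with 2 queries to $f^{(i)}$, and rejects if $H_{x^{(i)}}[f^{(i)}](s^{(i+1)})\ne f^{(i+1)}(s^{(i+1)})\cdot(s^{(i+1)}-z^{(i)})+B^{(i)}_{z^{(i)}}(x^{(i)})$; it rejects if $f^{(r)}(s^{(r)})\ne C$. If no repetition rejects, it accepts.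
   Formalization: When z lies in L^(i+1), QUOTIENT at y=z is 0/0 for the honest prover; it is taken there to be the value at z of the polynomial (G(X)-b)/(X-z), with G interpolating g. The O(log n) bounds are stated for n at least 2, since log 1 = 0. *)

(* Defs.v *)
From HB Require Import structures.
From mathcomp Require Import all_boot all_order all_algebra all_fingroup all_field.
From mathcomp Require Import all_classical all_reals all_analysis.

Set Implicit Arguments.
Unset Strict Implicit.
Unset Printing Implicit Defensive.

Import Order.TTheory GRing.Theory Num.Theory.

Local Open Scope ring_scope.

Definition word (F : finFieldType) (D : {set F}) : Type :=
  {ffun {x : F | x \in D} -> F}.

(* Evaluation at a field element; the value 0 outside of D is junk. *)
Definition ev (F : finFieldType) (D : {set F}) (f : word D) (x : F) : F :=
  if insub x is Some u then fun_of_fin f u else 0.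

Definition lagr (F : finFieldType) (D : {set F}) (a : F) : {poly F} :=
  \prod_(b in D :\ a) ((a - b)^-1 *: ('X - b%:P)).

(* The unique polynomial of degree < #|D| that agrees with f on D. *)
Definition interp (F : finFieldType) (D : {set F}) (f : F -> F) : {poly F} :=
  \sum_(a in D) f a *: lagr D a.

Lemma size_lagr (F : finFieldType) (D : {set F}) (a : F) :
  a \in D -> (size (lagr D a) <= #|D|)%N.
Proof.
move=> aD; rewrite (cardsD1 a D) aD add1n.
apply: leq_trans (size_poly_prod_leq _ _) _.
set S := (\sum_(_ in _) _)%N; suff leS : (S <= 2 * #|D :\ a|)%N.
  rewrite leq_subLR; apply: leq_trans (_ : (2 * #|D :\ a|).+1 <= _)%N => //.
  by rewrite mul2n -addnn addnS.
rewrite mulnC -sum_nat_const; apply: leq_sum => b _.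
by rewrite (leq_trans (size_scale_leq _ _)) // size_XsubC.
Qed.

Lemma size_interp (F : finFieldType) (D : {set F}) (f : F -> F) :
  (size (interp D f) <= #|D|)%N.
Proof.
apply: leq_trans (size_sum _ _ _) _; apply/bigmax_leqP => a aD.
exact: leq_trans (size_scale_leq _ _) (size_lagr aD).
Qed.

Lemma interpE (F : finFieldType) (D : {set F}) (f : F -> F) (x : F) :
  x \in D -> (interp D f).[x] = f x.
Proof.
move=> xD; rewrite horner_sum (bigD1 x) //= big1 => [|a /andP[aD ax]].
  rewrite addr0 hornerZ horner_prod big1 ?mulr1 // => b.
  rewrite !inE => /andP[bx bD].
  by rewrite hornerZ !hornerE mulVf // subr_eq0 eq_sym.
rewrite hornerZ horner_prod (bigD1 x) /=; last by rewrite !inE eq_sym ax xD.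
by rewrite hornerZ hornerXsubC subrr /= mulr0 mul0r mulr0.
Qed.

Definition RS (F : finFieldType) (D : {set F}) (d : nat) : {set word D} :=
  [set v : word D | (size (interp D (ev v)) <= d)%N].

Definition reldist (R : realType) (F : finFieldType) (D : {set F})
    (u v : word D) : R :=
  #|[set x | fun_of_fin u x != fun_of_fin v x]|%:R / #|D|%:R.

(* All distances are at most 1, so that the default value 1 is harmless for
   nonempty codes. *)
Definition codedist (R : realType) (F : finFieldType) (D : {set F})
    (u : word D) (V : {set word D}) : R :=
  \big[Num.min/1]_(v in V) reldist R u v.

Definition listsize (R : realType) (F : finFieldType) (D : {set F})
    (d : nat) (delta : R) : nat :=
  \max_(u : word D) #|[set v in RS D d | (reldist R u v < delta)%R]|.

(* QUOTIENT(g, z, b). For z in D the formula (g(y) - b) / (y - z) is 0 / 0 at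
   y = z in the honest protocol; the value there is the one of the polynomial
   (G(X) - b) / (X - z), with G the interpolating polynomial of g. *)
Definition quotient (F : finFieldType) (D : {set F}) (g : word D) (z b : F) :
    word D :=
  [ffun y => if val y != z then (ev g (val y) - b) / (val y - z)
             else ((interp D (ev g) - b%:P) %/ ('X - z%:P)).[z]].

Section Domains.

Context (F : finFieldType) (ch2 : 2%N \in [pchar F]) (k r : nat).

(* pPrimeCharType ch2 is F seen as a vector space over 'F_2. Only the indices
   i <= r (for Lsp) and i < r (for L0sp) matter. *)
Record domains := Domains {
  Lsp : nat -> {vspace pPrimeCharType ch2};
  L0sp : nat -> {vspace pPrimeCharType ch2};
  L (i : nat) : {set F} := [set x : F | (x : pPrimeCharType ch2) \in Lsp i];
  L0 (i : nat) : {set F} := [set x : F | (x : pPrimeCharType ch2) \in L0sp i];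
  q (i : nat) : {poly F} := \prod_(a in L0 i) ('X - a%:P);
  dim_L : forall i, (i <= r)%N -> \dim (Lsp i) = (k - i)%N;
  dim_L0 : forall i, (i < r)%N -> \dim (L0sp i) = 1%N;
  sub_L0 : forall i, (i < r)%N -> (L0sp i <= Lsp i)%VS;
  image_q : forall i, (i < r)%N -> L i.+1 = [set (q i).[x] | x in L i] }.

Variable dom : domains.

(* P_{f,s}, the interpolating polynomial of f on the two roots of q^(i)(X) - s. *)
Definition hash_poly (i : nat) (f : word (L dom i)) (s : F) : {poly F} :=
  interp [set y in L dom i | (q dom i).[y] == s] (ev f).

Definition hash (i : nat) (x : F) (f : word (L dom i)) : word (L dom i.+1) :=
  [ffun s => (hash_poly f (val s)).[x]].

Lemma card_L0 (i : nat) : (i < r)%N -> #|L0 dom i| = 2%N.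
Proof.
move=> ir; have := card_vspace (L0sp dom i).
rewrite dim_L0 // expn1 card_Fp // => <-.
by rewrite cardsE; apply: eq_card.
Qed.

Lemma size_hash_poly (i : nat) (f : word (L dom i)) (s : F) :
  (i < r)%N -> (size (hash_poly f s) <= 2)%N.
Proof.
move=> ir; apply: leq_trans (size_interp _ _) _.
have sq : size (q dom i) = 3%N.
  by rewrite /q -big_enum /= size_prod_XsubC -cardE card_L0.
have sqs : size (q dom i - s%:P) = 3%N.
  by rewrite size_polyDl sq // size_polyN (leq_ltn_trans (size_polyC_leq1 _)).
rewrite -ltnS -sqs cardE; apply: max_poly_roots.
- by rewrite -size_poly_eq0 sqs.
- apply/allP => y; rewrite mem_enum !inE => /andP[_ /eqP <-].
  by rewrite /root !hornerE subrr.
- exact: enum_uniq.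
Qed.

Record transcript := Transcript {
  tz : nat -> F;
  tB : nat -> {poly_2 F};
  tx : nat -> F;
  tf : forall i, word (L dom i);
  tC : F }.

Fixpoint qpath (s : F) (i : nat) : F :=
  if i is j.+1 then (q dom j).[qpath s j] else s.

Definition query_accepts (t : transcript) (s : F) : bool :=
  [forall i : 'I_r,
     ev (hash (tx t i) (tf t i)) (qpath s i.+1) ==
     ev (tf t i.+1) (qpath s i.+1) * (qpath s i.+1 - tz t i)
       + (tB t i).[tx t i]]
  && (ev (tf t r) (qpath s r) == tC t).

Definition queries (l : nat) := {ffun 'I_l -> {x : F | x \in L dom 0}}.

Definition accepts (l : nat) (t : transcript) (s : queries l) : bool :=
  [forall j, query_accepts t (val (s j))].

(* The verifier randomness (z^(i), x^(i)) of the COMMIT phase. *)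
Definition coins := r.-tuple (F * F).

(* An adaptive prover strategy: the first argument is the round and the second
   one is the list of the pairs (z^(j), x^(j)) already sent. *)
Record prover := Prover {
  sendB : nat -> seq (F * F) -> F -> {poly_2 F};
  sendf : forall i : nat, seq (F * F) -> word (L dom i.+1);
  sendC : seq (F * F) -> F }.

Definition run (P : prover) (f0 : word (L dom 0)) (c : coins) : transcript :=
  let z i := (nth (0, 0) c i).1 in
  let x i := (nth (0, 0) c i).2 in
  Transcript z
    (fun i => sendB P i (take i c) (z i))
    x
    (fun i => match i return word (L dom i) with
              | 0 => f0
              | j.+1 => sendf P j (take j.+1 c)
              end)
    (sendC P c).

(* B_z(X) = \sum_s P_{f,s}(X) lambda_s(z), with lambda_s the Lagrange basis of
   L^(i+1); see honestB_spec. *)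
Definition honestB (i : nat) (f : word (L dom i)) (z : F) : {poly_2 F} :=
  npolyp 2 (\sum_(s in L dom i.+1) (lagr (L dom i.+1) s).[z] *: hash_poly f s).

Lemma honestB_spec (i : nat) (f : word (L dom i)) (z x : F) : (i < r)%N ->
  (honestB f z).[x] = (interp (L dom i.+1) (ev (hash x f))).[z].
Proof.
move=> ir; rewrite /honestB npolypK; last first.
  apply: leq_trans (size_sum _ _ _) _; apply/bigmax_leqP => s _.
  by rewrite (leq_trans (size_scale_leq _ _)) ?size_hash_poly.
rewrite !horner_sum; apply: eq_bigr => s sL; rewrite !hornerZ mulrC.
by rewrite /ev insubT ffunE.
Qed.

Fixpoint honestf (f0 : word (L dom 0)) (h : seq (F * F)) (i : nat) :
    word (L dom i) :=
  match i return word (L dom i) with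
  | 0 => f0
  | j.+1 => let f := honestf f0 h j in
            let: (z, x) := nth (0, 0) h j in
            quotient (hash x f) z (honestB f z).[x]
  end.

Definition honest (f0 : word (L dom 0)) : prover :=
  Prover (fun i h z => honestB (honestf f0 h i) z)
         (fun i h => honestf f0 h i.+1)
         (fun h => ev (honestf f0 h r) 0).

End Domains.

Inductive arith := Add | Sub | Mul | Div.

(* Loop-free programs over registers indexed by nat, which can inspect field
   elements only through arithmetic operations and zero tests. Destination
   registers come first. Div is the total division of fieldType. [Query d t i]
   reads oracle number t at the point stored in register i. A program may depend
   on the field and on the domains, but not on the inputs or on the messages. *)
Inductive prog (F : Type) :=
| Nop
| Then of prog F & prog F
| Const of nat & F
| Arith of nat & arith & nat & nat
| IfZero of nat & prog F & prog F
| Recv of nat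
| Send of nat
| Query of nat & nat & nat.

Inductive event (F : Type) := Received of F | Sent of F.

(* nops counts the arithmetic operations, constant loads and zero tests. *)
Record state (F : Type) := State {
  reg : nat -> F;
  inbox : seq F;
  trace : seq (event F);
  nops : nat;
  nqueries : nat }.

Definition arith_sem (F : fieldType) (o : arith) : F -> F -> F :=
  match o with
  | Add => fun a b => a + b
  | Sub => fun a b => a - b
  | Mul => fun a b => a * b
  | Div => fun a b => a / b
  end.

Definition write (F : Type) (m : nat -> F) (d : nat) (a : F) : nat -> F :=
  fun i => if i == d then a else m i.

Fixpoint exec (F : fieldType) (orc : nat -> F -> F) (p : prog F) (s : state F) :
    state F :=
  let: State m ib tr n nq := s in
  match p with
  | Nop => s
  | Then p1 p2 => exec orc p2 (exec orc p1 s)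
  | Const d c => State (write m d c) ib tr n.+1 nq
  | Arith d o i j => State (write m d (arith_sem o (m i) (m j))) ib tr n.+1 nq
  | IfZero i p1 p2 =>
      exec orc (if m i == 0 then p1 else p2) (State m ib tr n.+1 nq)
  | Recv d => State (write m d (head 0 ib)) (behead ib)
                (rcons tr (Received (head 0 ib))) n nq
  | Send i => State m ib (rcons tr (Sent (m i))) n nq
  | Query d t i => State (write m d (orc t (m i))) ib tr n nq.+1
  end.

Section Complexity.

Context (F : finFieldType) (ch2 : 2%N \in [pchar F]) (k r : nat).
Context (dom : domains ch2 k r).

(* The interaction of the honest prover: the degree <= 1 polynomials are sent as
   their two coefficients, the oracles as their tables of values. The order of
   the events forces each message to be computed before the later verifier
   messages are known. *)
Definition honest_trace (f0 : word (L dom 0)) (c : coins F r) : seq (event F) :=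
  let t := run (honest f0) f0 c in
  flatten [seq [:: Received (tz t i); Sent (tB t i)`_0; Sent (tB t i)`_1;
                   Received (tx t i)]
               ++ [seq Sent a | a <- codom (tf t i.+1)] | i <- iota 0 r]
  ++ [:: Sent (tC t)].

(* Initially, the registers hold the table of values of f0. *)
Definition exec_prover (p : prog F) (f0 : word (L dom 0)) (c : coins F r) :
    state F :=
  exec (fun _ _ => 0) p
    (State (nth 0 (codom f0)) (flatten [seq [:: zx.1; zx.2] | zx <- c]) [::] 0 0).

(* The messages exchanged in the COMMIT phase, oracles excepted. *)
Definition messages (t : transcript dom) : seq F :=
  flatten [seq [:: tz t i; (tB t i)`_0; (tB t i)`_1; tx t i] | i <- iota 0 r]
  ++ [:: tC t].

(* Initially, the registers hold s^(0) and the messages; the verifier accepts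
   when register 0 finally holds 0. *)
Definition exec_query (p : prog F) (t : transcript dom) (s : F) : state F :=
  exec (fun i => ev (tf t i)) p
    (State (nth 0 (s :: messages t)) [::] [::] 0 0).

(* A query to an oracle transmits a point and a value. *)
Definition communication (t : transcript dom) (nq : nat) : nat :=
  size (messages t) + 2 * nq.

End Complexity.

(* Probability of A under the uniform distribution on T. *)
Definition Pr (R : realType) (T : finType) (A : pred T) : R :=
  #|A|%:R / #|T|%:R.

Definition log2 (R : realType) (x : R) : R := ln x / ln 2.

(* Main.v *)
(* Soundness. In round i the hash of f^(i) is u + x v for two words u, v on
   L^(i+1). If, for many (z, x), some polynomial P_x with P_x(z) = B_z(x) is
   close to u + x v, choose for each x the P_x in the (short) list of close
   polynomials that is right for most z. By convexity of the cube there are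
   x0 <> x1 such that for many x the polynomials of x0, x1 and x are right at
   more than d common points z. As B_z is affine, all these P_x lie on one line
   p0 + x p1. Averaging over x shows that u agrees with p0 and v with p1 on a
   large set, so that f^(i) agrees there with p0(q(X)) + X p1(q(X)). Hence,
   except with small probability, the best agreement of f^(i) with low degree on
   the points that passed all tests so far grows by at most epsilon per round.
   All agreements are counted on L^(0), which replaces weights on L^(i), and
   composition with q^(i) o ... o q^(0) bounds the lists on L^(i+1) by those on
   L^(0).

   The prover computes all values lambda_s(z) of the Lagrange basis in linear
   time from prefix and suffix products of the z - s. When z lies in the domain,
   the value of the quotient at z is recovered from the other ones, because its
   leading interpolation coefficient vanishes. *)

Require Import Defs.
From HB Require Import structures.
From mathcomp Require Import all_boot all_order all_algebra all_fingroup all_field.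
From mathcomp Require Import all_classical all_reals all_analysis.
From mathcomp Require Import fintype finset ring lra zify.

Set Implicit Arguments.
Unset Strict Implicit.
Unset Printing Implicit Defensive.

Import Order.TTheory GRing.Theory Num.Theory.

Local Open Scope ring_scope.

(** * Domains *)

Lemma forall_ordS (P : pred nat) (n : nat) :
  [forall j : 'I_n.+1, P j] = [forall j : 'I_n, P j] && P n.
Proof.
apply/forallP/andP => [H|[/forallP H Hn] [j jlt]].
  split; last exact: (H ord_max).
  by apply/forallP => j; apply: (H (widen_ord (leqnSn n) j)).
have /= := jlt; rewrite ltnS leq_eqVlt => /orP[/eqP -> //|ltjn].
exact: (H (Ordinal ltjn)).
Qed.

Section DomainFacts.

Context (F : finFieldType) (ch2 : 2%N \in [pchar F]) (k r : nat).
Variable dom : domains ch2 k r.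

Lemma card_L i : (i <= r)%N -> #|L dom i| = (2 ^ (k - i))%N.
Proof.
move=> ir; have := card_vspace (Lsp dom i).
rewrite dim_L // card_Fp // => <-.
by rewrite cardsE; apply: eq_card.
Qed.

Lemma in_L i x : (x \in L dom i) = ((x : pPrimeCharType ch2) \in Lsp dom i).
Proof. by case: dom; intros; rewrite inE. Qed.

Lemma in_L0 i x : (x \in L0 dom i) = ((x : pPrimeCharType ch2) \in L0sp dom i).
Proof. by case: dom; intros; rewrite inE. Qed.

Lemma L_0 i : 0 \in L dom i.
Proof. by rewrite in_L mem0v. Qed.

Lemma rounds_le_dim : (r <= k)%N.
Proof.
case: (posnP r) => [->//|r0].
have hr : (r.-1 < r)%N by rewrite prednK.
have := dimvS (sub_L0 dom hr).
by rewrite dim_L0 // dim_L ?leq_pred // subn_gt0 prednK.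
Qed.

Lemma L0_pair i : (i < r)%N -> exists2 w, w != 0 & L0 dom i = [set 0; w].
Proof.
move=> ir; have c2 := card_L0 dom ir.
have o0 : 0 \in L0 dom i by rewrite in_L0 mem0v.
have : #|L0 dom i :\ 0| == 1%N by have := cardsD1 0 (L0 dom i); rewrite o0 c2 => -[->].
case/cards1P=> w wE; exists w.
  have : w \in L0 dom i :\ 0 by rewrite wE in_set1 eqxx.
  by rewrite in_setD1 => /andP[].
by rewrite -(setD1K o0) wE.
Qed.

Lemma L_add i x y : x \in L dom i -> y \in L dom i -> x + y \in L dom i.
Proof. by rewrite !in_L; apply: memvD. Qed.

Lemma opp_ch2 (x : F) : - x = x.
Proof. by rewrite (oppr_pchar2 ch2). Qed.

Lemma L0_sub i w : (i < r)%N -> w \in L0 dom i -> w \in L dom i.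
Proof. by move=> ir; rewrite in_L0 in_L; apply: (subvP (sub_L0 dom ir)). Qed.

Lemma size_q i : (i < r)%N -> size (q dom i) = 3%N.
Proof.
by move=> ir; rewrite /q -big_enum /= size_prod_XsubC -cardE card_L0.
Qed.

Lemma qE i w x : w != 0 -> L0 dom i = [set 0; w] ->
  (q dom i).[x] = x * (x + w).
Proof.
move=> w0 E; rewrite /q E big_setU1 /=; last by rewrite inE eq_sym.
by rewrite big_set1 !hornerE /= !(oppr_pchar2 ch2) ?addr0.
Qed.

(** In characteristic 2, q(x) - q(y) = (x - y)(x - y - w), because the two sides differ by a
    multiple of 2. *)
Lemma q_fibre i w y : (i < r)%N -> w != 0 -> L0 dom i = [set 0; w] ->
  y \in L dom i ->
  [set x in L dom i | (q dom i).[x] == (q dom i).[y]] = [set y; y + w].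
Proof.
move=> ir w0 E yL; apply/setP => x; rewrite in_set in_set2 !(qE _ w0 E).
have wL : w \in L dom i by apply: L0_sub => //; rewrite E in_set2 eqxx orbT.
apply/andP/orP => [[xL /eqP h]|].
  have : (x - y) * (x - (y + w)) = 0.
    have -> : (x - y) * (x - (y + w)) =
      x * (x + w) - y * (y + w) - (x * w - y * w + x * y - y * y)  *+ 2.
      by ring.
    by rewrite h subrr sub0r -mulr_natr (pcharf0 ch2) mulr0 oppr0.
  by move/eqP; rewrite mulf_eq0 !subr_eq0 => /orP.
case=> /eqP ->; first by rewrite eqxx yL.
rewrite (L_add yL wL); split=> //.
have -> : (y + w) * (y + w + w) = y * (y + w) + (y * w + w * w) *+ 2 by ring.
by rewrite -mulr_natr (pcharf0 ch2) mulr0 addr0.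
Qed.

Lemma qpath_L s i : s \in L dom 0 -> (i <= r)%N -> qpath dom s i \in L dom i.
Proof.
move=> sL; elim: i => // i IH ir.
by rewrite image_q //= imset_f // IH // ltnW.
Qed.

(** Polynomial form of [qpath]; composing with it pulls low-degree polynomials on L^(i) back to
    L^(0). *)
Fixpoint qcomp i : {poly F} := if i is j.+1 then q dom j \Po qcomp j else 'X.

Lemma qcompE s i : (qcomp i).[s] = qpath dom s i.
Proof. by elim: i => [|i IH] /=; rewrite ?hornerX // horner_comp IH. Qed.

Lemma size_qcomp i : (i <= r)%N -> size (qcomp i) = (2 ^ i).+1.
Proof.
elim: i => [|i IH] ir /=; first by rewrite size_polyX.
have := size_comp_poly (q dom i) (qcomp i).
rewrite size_q // IH ?(ltnW ir) //= -expnS => h.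
have : size (q dom i \Po qcomp i) != 0%N.
  by apply: contra_eq_neq h => ->; rewrite eq_sym /= expn_eq0.
by case: size h => //= m ->.
Qed.

Lemma hash_polyE i (f : word (L dom i)) y : y \in L dom i ->
  (hash_poly f (q dom i).[y]).[y] = ev f y.
Proof.
by move=> yL; rewrite /hash_poly interpE // in_set eqxx yL.
Qed.

Lemma ev_hash i (x : F) (f : word (L dom i)) s :
  s \in L dom i.+1 -> ev (hash x f) s = (hash_poly f s).[x].
Proof. by move=> sL; rewrite /ev insubT ffunE. Qed.

End DomainFacts.

Lemma ev_val (F : finFieldType) (D : {set F}) (f : word D) (t : {x : F | x \in D}) :
  ev f (val t) = fun_of_fin f t.
Proof. by rewrite /ev valK. Qed.

Lemma poly_agree (F : finFieldType) (D : {set F}) (p p' : {poly F}) (d : nat) :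
  (d <= #|D|)%N -> (size p <= d)%N -> (size p' <= d)%N ->
  {in D, forall x, p.[x] = p'.[x]} -> p = p'.
Proof.
move=> dD sp sp' h; apply/eqP; rewrite -subr_eq0; apply/eqP.
apply: (@roots_geq_poly_eq0 _ _ (enum D)); last first.
- rewrite -cardE; apply: leq_trans (size_polyD _ _) _.
  by rewrite size_polyN geq_max (leq_trans sp) // (leq_trans sp').
- exact: enum_uniq.
by apply/allP => x; rewrite mem_enum => xD; rewrite rootE !hornerE h // subrr.
Qed.

Lemma interp_uniq (F : finFieldType) (D : {set F}) (f : F -> F) (p : {poly F}) :
  (size p <= #|D|)%N -> {in D, forall x, p.[x] = f x} -> interp D f = p.
Proof.
move=> sp h; apply: (@poly_agree _ D _ _ #|D|) => //; first exact: size_interp.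
by move=> x xD; rewrite interpE // h.
Qed.

(** * The DEEP method *)

(** On the nonnegative reals the cube lies above its tangent at [m]: the gap is (g - m)^2 (g + 2
    m). *)
Lemma sum_cube_ge (R : realFieldType) (T : finType) (g : T -> R) (m s : R) :
  0 <= m -> (forall t, 0 <= g t) -> \sum_t g t = s ->
  3 * m ^+ 2 * s - 2 * m ^+ 3 * #|T|%:R <= \sum_t g t ^+ 3.
Proof.
move=> m0 g0 <-; rewrite mulr_sumr -sum1_card.
rewrite natr_sum mulr_sumr -sumrB; apply: ler_sum => t _.
rewrite mulr1 -subr_ge0.
have -> : g t ^+ 3 - (3 * m ^+ 2 * g t - 2 * m ^+ 3) = (g t - m) ^+ 2 * (g t + 2 * m).
  by ring.
by rewrite mulr_ge0 ?sqr_ge0 // addr_ge0 // mulr_ge0.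
Qed.

Section Deep.

Context (R : realFieldType) (F : finFieldType) (T : finType).
Variables (W : pred T) (u v y : T -> F) (d Lst : nat).
Variables (B : F -> {poly F}) (a eps kappa : R).

(** One round in the abstract. In the application [T] is L^(0), [W] selects the points that passed
    all earlier tests, [y] maps to L^(i+1), and [u] + x [v] is the hash with challenge x. *)
Definition agree (x : F) (p : {poly F}) : nat :=
  #|[set t | W t && (u t + x * v t == p.[y t])]|.

Definition close (x : F) : {set {poly_d F}} :=
  [set p : {poly_d F} | a < (agree x p)%:R].

Definition deep_event (z x : F) : bool :=
  [exists p : {poly_d F}, (p \in close x) && ((val p).[z] == (B z).[x])].

Hypothesis close_le : forall x, (#|close x| <= Lst)%N.
Hypothesis size_B : forall z, (size (B z) <= 2)%N.

Let N (x : F) (p : {poly_d F}) : nat := #|[set z | (val p).[z] == (B z).[x]]|.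

(** [P x] is a close polynomial that matches B_z(x) for the most z, and [S x] is its set of matches,
    empty when nothing is close. Each z of the event is matched by one of the at most [Lst] close
    polynomials, so the best one accounts for a 1/[Lst] share. *)
Lemma deep_selection :
  exists (P : F -> {poly_d F}) (S : F -> {set F}),
    (forall x z, z \in S x -> P x \in close x /\ (val (P x)).[z] = (B z).[x]) /\
    (forall x, #|[set z | deep_event z x]| <= Lst * #|S x|)%N.
Proof.
have [P hP] : {P : F -> {poly_d F} & forall x, close x != set0 ->
    P x \in close x /\ forall p, p \in close x -> (N x p <= N x (P x))%N}.
  apply: (@choice F {poly_d F} (fun x p0 => close x != set0 ->
    p0 \in close x /\ forall p, p \in close x -> (N x p <= N x p0)%N)) => x.
  case: (set_0Vmem (close x)) => [->|[p0 p0c]]; first by exists 0; rewrite eqxx.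
  by case: (@arg_maxnP _ p0 (mem (close x)) (N x) p0c) => p pc pm; exists p.
exists P, (fun x => if close x == set0 then set0
  else [set z | (val (P x)).[z] == (B z).[x]]); split=> [x z|x].
  case: ifPn => [|ne]; first by rewrite in_set0.
  by rewrite in_set => /eqP ->; split=> //; case: (hP x ne).
case: ifPn => [/eqP e|ne].
  rewrite [X in (X <= _)%N](_ : _ = 0%N) //; apply/eqP; rewrite cards_eq0.
  apply/eqP/setP => z; rewrite in_set in_set0; apply/existsP => -[p].
  by rewrite e in_set0.
have [_ pm] := hP x ne.
apply: (@leq_trans (\sum_(p in close x) N x p)).
  rewrite -sum1_card.
  under [X in (_ <= X)%N]eq_bigr do rewrite /N -sum1_card big_mkcond.
  rewrite exchange_big /= big_mkcond /=; apply: leq_sum => z _.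
  rewrite in_set; case: ifP => // /existsP[p /andP[pc pz]].
  by rewrite (bigD1 p) //= in_set pz.
apply: (@leq_trans (\sum_(p in close x) N x (P x))); first exact: leq_sum.
by rewrite sum_nat_const leq_mul2r close_le orbT.
Qed.

Hypothesis eps_gt0 : 0 < eps.
Hypothesis eps_lt1 : eps < 1.
Hypothesis q_large : 4 <= eps ^+ 2 * #|F|%:R.
Hypothesis kappa_ge0 : 0 <= kappa.
Hypothesis kappa_cube : 8 * (d%:R + eps * #|F|%:R) <= kappa ^+ 3 * #|F|%:R.
Hypothesis event_large :
  Lst%:R * kappa * #|F|%:R ^+ 2
    < #|[set zx : F * F | deep_event zx.1 zx.2]|%:R.

Let q : R := #|F|%:R.

(** Summing over z the cube of the number of x with z in [S x] counts all triple intersections. The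
    tangent bound makes this exceed 8 (d + eps q) q^3, while the pairs x0 = x1 contribute at most
    q^3, so some other pair exceeds its share. *)
Lemma deep_triples (S : F -> {set F}) :
  (forall x, #|[set z | deep_event z x]| <= Lst * #|S x|)%N ->
  exists x0 x1, x0 != x1 /\
    8 * (d%:R + eps * q) * q - q
      < \sum_(x : F) #|S x0 :&: S x1 :&: S x|%:R.
Proof.
move=> hS.
have q0 : 0 < q by rewrite ltr0n; apply/card_gt0P; exists 0.
have kq : kappa * q ^+ 2 < \sum_x #|S x|%:R.
  have Ecard : #|[set zx : F * F | deep_event zx.1 zx.2]|
      = (\sum_x #|[set z | deep_event z x]|)%N.
    rewrite -sum1_card big_mkcond /=.
    under [RHS]eq_bigr do rewrite -sum1_card big_mkcond /=.
    rewrite [RHS]exchange_big pair_bigA /=; apply: eq_bigr => -[z x] _.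
    by rewrite !in_set.
  have le : (#|[set zx : F * F | deep_event zx.1 zx.2]|%:R : R)
      <= Lst%:R * \sum_x #|S x|%:R.
    rewrite Ecard -natr_sum -natrM ler_nat big_distrr /=.
    exact: leq_sum.
  have := lt_le_trans event_large le.
  rewrite -mulrA; case: (posnP Lst) => [->|L0].
    by rewrite !mul0r ltxx.
  by rewrite ltr_pM2l // ltr0n.
pose I x z : R := (z \in S x)%:R.
have cardI (A : {set F}) : (#|A|%:R : R) = \sum_z (z \in A)%:R.
  by rewrite -sum1_card natr_sum big_mkcond; apply: eq_bigr => z _; case: ifP.
have k0 : 0 < kappa.
  rewrite lt_def kappa_ge0 andbT; apply/eqP => k0; move: kappa_cube.
  rewrite k0 expr0n mul0r; apply/negP; rewrite -ltNge mulr_gt0 //.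
  by rewrite ltr_wpDl // mulr_gt0.
have cube : kappa ^+ 3 * q ^+ 4 < \sum_z (\sum_x I x z) ^+ 3.
  have sumI : \sum_z \sum_x I x z = \sum_x #|S x|%:R.
    by rewrite exchange_big /=; apply: eq_bigr => x _; rewrite cardI.
  (* The tangent is taken at [kappa * q], a lower bound for the mean over z of the inner sum. *)
  apply: lt_le_trans (sum_cube_ge (m := kappa * q) _ _ sumI).
  - have -> : kappa ^+ 3 * q ^+ 4 = 3 * (kappa * q) ^+ 2 * (kappa * q ^+ 2)
       - 2 * (kappa * q) ^+ 3 * q by ring.
    by rewrite ltrD2r ltr_pM2l // mulr_gt0 // exprn_gt0 // mulr_gt0.
  - by rewrite mulr_ge0 // ltW.
  - by move=> z; apply: sumr_ge0 => x _; rewrite ler0n.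
have expand : \sum_z (\sum_x I x z) ^+ 3
    = \sum_x0 \sum_x1 \sum_x #|S x0 :&: S x1 :&: S x|%:R.
  transitivity (\sum_z \sum_x0 \sum_x1 \sum_x I x0 z * I x1 z * I x z).
    apply: eq_bigr => z _; rewrite !exprS expr0 mulr1 mulrA.
    rewrite !mulr_suml; apply: eq_bigr => x0 _.
    rewrite [I x0 z * _]mulr_sumr mulr_suml; apply: eq_bigr => x1 _.
    by rewrite mulr_sumr.
  rewrite exchange_big; apply: eq_bigr => x0 _.
  rewrite exchange_big; apply: eq_bigr => x1 _.
  rewrite exchange_big; apply: eq_bigr => x _.
  rewrite cardI; apply: eq_bigr => z _; rewrite !in_setI /I.
  by do 3 case: (z \in _); rewrite ?mulr0 ?mul0r ?mulr1.
set K := 8 * _ * q - q.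
(* [q_large] and [eps_lt1] give eps q >= 4, hence K >= 0; the diagonal case of [bound] relies on
   it. *)
have K0 : 0 <= K.
  have : q <= 8 * (d%:R + eps * q) * q.
    rewrite ler_peMl ?(ltW q0) //.
    have : 4 <= eps * (eps * q) by rewrite mulrA -expr2.
    have : eps * (eps * q) <= eps * q by rewrite ler_piMl ?(ltW eps_lt1) // ltW // mulr_gt0.
    have : (0 : R) <= d%:R by rewrite ler0n.
    by lra.
  by rewrite /K; lra.
apply: contrapT => no.
have bound x0 x1 : \sum_x #|S x0 :&: S x1 :&: S x|%:R
    <= K + (if x0 == x1 then q ^+ 2 else 0).
  case: eqVneq => [_|ne].
    apply: (@le_trans _ _ (\sum_(x : F) q)).
      by apply: ler_sum => x _; rewrite ler_nat max_card.
    by rewrite sumr_const -mulr_natr -/q -expr2 lerDr.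
  rewrite addr0 leNgt; apply/negP => lt; apply: no; exists x0, x1.
  by split.
have : \sum_x0 \sum_x1 \sum_x #|S x0 :&: S x1 :&: S x|%:R
    <= 8 * (d%:R + eps * q) * q ^+ 3.
  apply: (@le_trans _ _ (\sum_(x0 : F) (K * q + q ^+ 2))).
    apply: ler_sum => x0 _.
    apply: (@le_trans _ _ (\sum_(x1 : F) (K + (if x0 == x1 then q ^+ 2 else 0)))).
      exact: ler_sum.
    rewrite big_split /= sumr_const -mulr_natr lerD2l -big_mkcond /=.
    by rewrite (eq_bigl (pred1 x0)) ?big_pred1_eq // => x1; rewrite eq_sym.
  rewrite sumr_const -mulr_natr -/q le_eqVlt; apply/orP; left; apply/eqP.
  by rewrite /K; ring.
rewrite -expand; apply/negP; rewrite -ltNge; apply: le_lt_trans cube.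
have -> : kappa ^+ 3 * q ^+ 4 = kappa ^+ 3 * q * q ^+ 3 by ring.
by rewrite ler_pM2r // exprn_gt0.
Qed.

(** As B_z is affine, its values at x0, x1 and x are collinear for each z. Both sides thus agree on
    [S], which has more than d points, and both have size at most d. [c1] is the slope of the
    line. *)
Lemma deep_line (p0 p1 p : {poly F}) (x0 x1 x : F) (S : {set F}) :
  x0 != x1 -> (size p0 <= d)%N -> (size p1 <= d)%N -> (size p <= d)%N ->
  (d < #|S|)%N ->
  (forall z, z \in S -> [/\ p0.[z] = (B z).[x0], p1.[z] = (B z).[x1]
                          & p.[z] = (B z).[x]]) ->
  let c1 := (x0 - x1)^-1 *: (p0 - p1) in
  p = (p0 - x0 *: c1) + x *: c1.
Proof.
move=> x01 s0 s1 sp dS h c1.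
have sc : (size c1 <= d)%N.
  apply: leq_trans (size_scale_leq _ _) _; apply: leq_trans (size_polyD _ _) _.
  by rewrite size_polyN geq_max s0.
apply: (@poly_agree _ S _ _ d (ltnW dS)) => //.
  apply: leq_trans (size_polyD _ _) _.
  rewrite geq_max (leq_trans (size_scale_leq _ _)) // andbT.
  apply: leq_trans (size_polyD _ _) _; rewrite size_polyN geq_max s0 /=.
  exact: leq_trans (size_scale_leq _ _) _.
move=> z /h [e0 e1 e].
have [b0 [b1 hB]] : exists b0 b1, forall t, (B z).[t] = b0 + t * b1.
  exists (B z)`_0, (B z)`_1 => t.
  rewrite (horner_coef_wide _ (size_B z)) !big_ord_recl big_ord0 /=.
  by rewrite expr0 expr1 mulr1 addr0 mulrC [t * _]mulrC mulrC.
have ec : c1.[z] = b1.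
  rewrite /c1 !(hornerZ, hornerD, hornerN) e0 e1 !hB opprD addrACA subrr add0r -mulrBl mulKf //.
  by rewrite subr_eq0.
clearbody c1; by rewrite !(hornerZ, hornerD, hornerN) e e0 ec !hB; ring.
Qed.

Lemma deep_line_agree : exists p0 p1 : {poly F},
  [/\ (size p0 <= d)%N, (size p1 <= d)%N
    & a - eps * #|T|%:R
      < #|[set t | [&& W t, u t == p0.[y t] & v t == p1.[y t]]]|%:R].
Proof.
have [P [S [PS hS]]] := deep_selection.
have [x0 [x1 [x01 big]]] := deep_triples hS.
have q0 : 0 < q by rewrite ltr0n; apply/card_gt0P; exists 0.
(* For x in [A], [deep_line] puts [P x] on the line through [P x0] and [P x1]. *)
pose A := [set x | (d < #|S x0 :&: S x1 :&: S x|)%N].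
(* Terms in [A] are at most q and the others at most d, so d + |A| > 8 (d + eps q) - 1, and
   [q_large] yields eps |A| > 1. *)
have cardA : 1 < eps * #|A|%:R.
  have : \sum_x #|S x0 :&: S x1 :&: S x|%:R <= (d%:R + #|A|%:R) * q.
    apply: (@le_trans _ _ (\sum_(x : F) (d%:R + (if x \in A then q else 0)))).
      apply: ler_sum => x _; rewrite in_set; case: ifPn => [_|].
        by rewrite ler_wpDl // ler_nat max_card.
      by rewrite -leqNgt addr0 ler_nat.
    rewrite big_split /= sumr_const -big_mkcond sumr_const /= mulrDl.
    by rewrite -[q *+ _]mulr_natl -[d%:R *+ _]mulr_natr.
  move/(lt_le_trans big) => lt.
  have {lt} : (8 * (d%:R + eps * q) - 1) * q < (d%:R + #|A|%:R) * q.
    by rewrite mulrBl mul1r.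
  rewrite ltr_pM2r // => lt.
  have d0 : (0 : R) <= d%:R by rewrite ler0n.
  have : eps * (8 * (eps * q) - 1) < eps * #|A|%:R by rewrite ltr_pM2l //; lra.
  have : 4 <= eps * (eps * q) by rewrite mulrA -expr2.
  by have := eps_lt1; rewrite mulrBr; lra.
pose c1 := (x0 - x1)^-1 *: (val (P x0) - val (P x1)).
pose c0 := val (P x0) - x0 *: c1.
have line x : x \in A -> P x \in close x /\ val (P x) = c0 + x *: c1.
  rewrite in_set => dA; split.
    have /card_gt0P[z] := leq_ltn_trans (leq0n d) dA.
    by rewrite in_setI => /andP[_ /PS[]].
  apply: (deep_line x01 _ _ _ dA); rewrite ?size_npoly // => z.
  by rewrite !in_setI => /andP[/andP[/PS[_ ->] /PS[_ ->]] /PS[_ ->]].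
have sc1 : (size c1 <= d)%N.
  apply: leq_trans (size_scale_leq _ _) _; apply: leq_trans (size_polyD _ _) _.
  by rewrite size_polyN geq_max !size_npoly.
have sc0 : (size c0 <= d)%N.
  apply: leq_trans (size_polyD _ _) _; rewrite size_polyN geq_max size_npoly.
  exact: leq_trans (size_scale_leq _ _) _.
clearbody c0 c1; exists c0, c1; split=> //.
set C := [set t | _].
pose ok t x := W t && (u t + x * v t == (c0 + x *: c1).[y t]).
(* A point outside [C] either fails [W] or poses a nontrivial affine equation in x, so at most one x
   passes. *)
have count t : (\sum_(x in A) ok t x <= #|A| * (t \in C) + 1)%N.
  rewrite in_set /ok; case Wt: (W t) => /=; last by rewrite big1 ?muln0.
  case: (altP (u t =P c0.[y t])) => [eu|nu] /=.
    case: (altP (v t =P c1.[y t])) => [ev|nv] /=.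
      apply: (@leq_trans (\sum_(x in A) 1)); last by rewrite sum1_card muln1 leq_addr.
      by apply: leq_sum => x _; case: eqP.
    rewrite muln0 (bigID (pred1 0)) /= [X in (_ + X)%N]big1 ?addn0; last first.
      move=> x /andP[_ x0']; apply/eqP; rewrite eqb0 !hornerE eu; apply: contra nv.
      by rewrite (inj_eq (addrI _)) => /eqP/(mulfI x0')->.
    apply: (@leq_trans (\sum_(x | pred1 0 x) 1)); last by rewrite big_pred1_eq.
    rewrite big_mkcondl; apply: leq_sum => x _; case: ifP => // _.
    by case: eqP.
  (* If [v t] equals [c1.[y t]], then [e] is 0 by the convention on division by zero, and no x
     passes because the constant term is nonzero. *)
  rewrite muln0; set e := (c0.[y t] - u t) / (v t - c1.[y t]).
  rewrite (bigID (pred1 e)) /= [X in (_ + X)%N]big1 ?addn0; last first.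
    move=> x /andP[_ xe]; apply/eqP; rewrite eqb0 !hornerE; apply: contra xe.
    move=> /eqP h; have hx : x * (v t - c1.[y t]) = c0.[y t] - u t.
      apply/eqP; rewrite -subr_eq0; apply/eqP.
      transitivity (u t + x * v t - (c0.[y t] + x * c1.[y t])); first by ring.
      by rewrite h subrr.
    rewrite /e -hx mulfK //; apply: contra nu => /eqP e0.
    by rewrite eq_sym -subr_eq0 -hx e0 mulr0.
  apply: (@leq_trans (\sum_(x | pred1 e x) 1)); last by rewrite big_pred1_eq.
  rewrite big_mkcondl; apply: leq_sum => x _; case: ifP => // _.
  by case: eqP.
have A0 : (0 < #|A|)%N.
  by case: (posnP #|A|) cardA => // ->; rewrite mulr0 ltNge ler01.
(* The passing pairs (x, t) with x in [A] are counted in two ways: each x contributes more than [a],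
   and each t at most one, plus |A| if it lies in [C]. *)
have lower : a * #|A|%:R < (\sum_(x in A) agree x (c0 + x *: c1))%:R.
  rewrite natr_sum mulr_natr -sumr_const; apply: ltr_sum.
    by have [x xA] := card_gt0P A0; apply/hasP; exists x; rewrite ?mem_index_enum.
  by move=> x /line[]; rewrite in_set => lt <-.
have upper : (\sum_(x in A) agree x (c0 + x *: c1) <= #|A| * #|C| + #|T|)%N.
  have -> : (\sum_(x in A) agree x (c0 + x *: c1) = \sum_t \sum_(x in A)
      ok t x)%N.
    rewrite exchange_big /=; apply: eq_bigr => x _; rewrite /agree -sum1_card.
    by rewrite big_mkcond; apply: eq_bigr => t _; rewrite in_set /ok; case: (_ && _).
  apply: leq_trans (leq_sum _ (fun t _ => count t)) _.
  rewrite big_split /= sum1_card leq_add2r -big_distrr /= leq_mul2l.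
  apply/orP; right; rewrite -sum1_card [leqRHS]big_mkcond.
  by apply: leq_sum => t _; case: (_ \in _).
have {lower} : a * #|A|%:R < #|A|%:R * #|C|%:R + #|T|%:R.
  by apply: lt_le_trans lower _; rewrite -natrM -natrD ler_nat.
have A0' : (0 : R) < #|A|%:R by rewrite ltr0n.
(* Since eps |A| > 1, the error |T| is absorbed by eps |T| |A|; it remains to divide by |A|. *)
have : #|T|%:R <= eps * #|T|%:R * #|A|%:R :> R.
  by rewrite mulrAC ler_peMl ?ler0n // ltW.
move=> h1 h2; rewrite -(ltr_pM2r A0'); lra.
Qed.

End Deep.

(** * Soundness *)

Lemma cube_root (R : realType) (x : R) : 0 <= x -> (x `^ (3^-1)) ^+ 3 = x.
Proof.
move=> x0; rewrite -powR_mulrn ?powR_ge0 // -powRrM mulVf ?powRr1 //.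
Qed.

Lemma card_word_dom (F : finFieldType) (D : {set F}) :
  #|{: {x : F | x \in D}}| = #|D|.
Proof. by rewrite card_sig; apply: eq_card => x; rewrite !inE. Qed.

Lemma card_agree_disagree (F : finFieldType) (D : {set F}) (u v : word D) :
  (#|[set t | fun_of_fin u t == fun_of_fin v t]|
   + #|[set t | fun_of_fin u t != fun_of_fin v t]| = #|D|)%N.
Proof.
rewrite -card_word_dom -(cardsC [set t | fun_of_fin u t == fun_of_fin v t]).
by congr (_ + _)%N; apply: eq_card => t; rewrite !inE.
Qed.

Lemma RS_poly (F : finFieldType) (D : {set F}) (d : nat) (p : {poly F}) :
  (d <= #|D|)%N -> (size p <= d)%N -> [ffun t => p.[val t]] \in RS D d.
Proof.
move=> dD sp; rewrite in_set (@interp_uniq _ _ _ p) ?(leq_trans sp) // => x xD.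
by rewrite /ev insubT ffunE.
Qed.

Lemma size_comp_q (F : finFieldType) (ch2 : 2%N \in [pchar F]) (k r : nat)
    (dom : domains ch2 k r) (i m : nat) (c : {poly F}) :
  (i < r)%N -> (size c <= m.+1)%N -> (size (c \Po q dom i)%R <= (2 * m).+1)%N.
Proof.
move=> ir sc; have := size_comp_poly c (q dom i); rewrite size_q //= => e.
by move: e sc; case: (size c) (size (c \Po q dom i)%R) => [|a] b /=; clear; lia.
Qed.

(* d^(i) in the paper. *)
Definition deg_bound (r i : nat) : nat := (3 * 2 ^ (r - i) - 2)%N.

(** A hash halves the degree bound and a quotient lowers it by one. The closed form solves this
    recursion with final value 1, that is, a constant last oracle. *)
Lemma deg_boundS r i : (i < r)%N -> deg_bound r i = (2 * (deg_bound r i.+1).+1)%N.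
Proof.
move=> ir; rewrite /deg_bound (subnS r i); have : (0 < r - i)%N by rewrite subn_gt0.
case: (r - i)%N => // m _; rewrite expnS /=; have : (0 < 2 ^ m)%N by rewrite expn_gt0.
by lia.
Qed.

Lemma deg_bound_lt r i : (i < r)%N -> (deg_bound r i.+1 < deg_bound r 0)%N.
Proof.
move=> ir; rewrite /deg_bound subn0.
have : (2 ^ (r - i.+1) < 2 ^ r)%N by rewrite ltn_exp2l //; lia.
have : (0 < 2 ^ (r - i.+1))%N by rewrite expn_gt0.
by lia.
Qed.

(** * Redrawing one verifier coin *)

Section CoinAveraging.

Variables (A : finType) (a0 : A) (r i : nat).
Hypothesis ir : (i < r)%N.

Definition set_coin (c : r.-tuple A) (w : A) : r.-tuple A :=
  [tuple if val j == i then w else tnth c j | j < r].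

Lemma nth_set_coin c w j : (j < r)%N ->
  nth a0 (set_coin c w) j = if j == i then w else nth a0 c j.
Proof.
by move=> jr; rewrite -(tnth_nth a0 _ (Ordinal jr)) tnth_mktuple (tnth_nth a0).
Qed.

Lemma take_set_coin c w : take i (set_coin c w) = take i c.
Proof.
apply: (@eq_from_nth _ a0); first by rewrite !size_take !size_tuple.
move=> j; rewrite size_take size_tuple ir => ji.
by rewrite !nth_take // nth_set_coin ?(ltn_trans ji) // ltn_eqF.
Qed.

Lemma set_coinK c w : set_coin (set_coin c w) (nth a0 c i) = c.
Proof.
apply: val_inj; apply: (@eq_from_nth _ a0); rewrite !size_tuple // => j jr.
by rewrite !nth_set_coin //; case: eqP => // ->.
Qed.

(* (c, w) |-> (c with i-th coin w, old i-th coin) is an involution, so that the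
   i-th coin may be drawn afresh. *)
Lemma card_fresh_coin (R : realFieldType) (E : seq A -> A -> bool) (M : R) :
  (forall h, #|[set w | E h w]|%:R <= M * #|A|%:R) ->
  #|[set c : r.-tuple A | E (take i c) (nth a0 c i)]|%:R
    <= M * #|{: r.-tuple A}|%:R.
Proof.
move=> hE; have A0 : (0 : R) < #|A|%:R by rewrite ltr0n; apply/card_gt0P; exists a0.
rewrite -(ler_pM2r A0).
have -> : #|[set c : r.-tuple A | E (take i c) (nth a0 c i)]|%:R * #|A|%:R
    = \sum_(c : r.-tuple A) #|[set w | E (take i c) w]|%:R :> R.
  rewrite -natrM -natr_sum; congr (_%:R).
  transitivity (\sum_(c : r.-tuple A) \sum_(w : A) E (take i c) (nth a0 c i))%N.
    rewrite -sum1_card big_distrl big_mkcond /=; apply: eq_bigr => c _.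
    by rewrite sum_nat_const in_set; case: (E _ _); rewrite ?muln0 ?muln1 ?mul1n.
  rewrite pair_bigA /=.
  rewrite (reindex_inj (h := fun cw => (set_coin cw.1 cw.2, nth a0 cw.1 i))).
    rewrite -(pair_bigA _ (fun c w =>
      E (take i (set_coin c w)) (nth a0 (set_coin c w) i) : nat)) /=.
    apply: eq_bigr => c _; rewrite -sum1_card [RHS]big_mkcond; apply: eq_bigr => w _.
    by rewrite take_set_coin nth_set_coin // eqxx in_set; case: (E _ _).
  apply: inv_inj => -[c w] /=.
  by rewrite set_coinK nth_set_coin // eqxx.
apply: (@le_trans _ _ (\sum_(c : r.-tuple A) M * #|A|%:R)); first exact: ler_sum.
by rewrite sumr_const -[_ *+ _]mulr_natr mulrAC.
Qed.

End CoinAveraging.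

Lemma Pr_le1 (R : realType) (T : finType) (A : pred T) : Pr R A <= 1.
Proof.
rewrite /Pr; case: (posnP #|T|) => [->|T0]; first by rewrite invr0 mulr0.
by rewrite ler_pdivrMr ?ltr0n // mul1r ler_nat max_card.
Qed.

(** The accepting query vectors are the functions from the repetitions to the accepting points,
    which gives the power [l]. *)
Lemma Pr_accepts (R : realType) (F : finFieldType) (ch2 : 2%N \in [pchar F])
    (k r l : nat) (dom : domains ch2 k r) (t : transcript dom) :
  Pr R [pred s : queries dom l | accepts t s]
  = (#|[set s : {x : F | x \in L dom 0} | query_accepts t (val s)]|%:R
     / #|L dom 0|%:R) ^+ l.
Proof.
rewrite /Pr expr_div_n -!natrX; congr (_%:R / _%:R); last first.
  by rewrite card_ffun card_ord card_word_dom.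
rewrite -[X in (_ ^ X)%N](card_ord l) -card_ffun_on; apply: eq_card => s.
rewrite !inE; apply/forallP/ffun_onP => H j; have := H j; rewrite in_set //.
Qed.

(** * Runs of an adaptive prover and their bad rounds *)

Section Soundness.

Context (R : realType) (F : finFieldType) (ch2 : 2%N \in [pchar F]) (k r : nat).
Variables (dom : domains ch2 k r) (P : prover dom) (f0 : word (L dom 0)).

(** An arbitrary coin list replaces the full tuple of coins, so that an event of round i can be
    stated for a fixed prefix. *)
Definition hist_f (h : seq (F * F)) (i : nat) : word (L dom i) :=
  match i return word (L dom i) with
  | 0 => f0
  | j.+1 => sendf P j (take j.+1 h)
  end.

Definition hist_test (h : seq (F * F)) (j : nat) (s : F) : bool :=
  ev (hash (nth (0, 0) h j).2 (hist_f h j)) (qpath dom s j.+1) ==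
  ev (hist_f h j.+1) (qpath dom s j.+1)
    * (qpath dom s j.+1 - (nth (0, 0) h j).1)
  + (sendB P j (take j h) (nth (0, 0) h j).1).[(nth (0, 0) h j).2].

Definition passed (h : seq (F * F)) (i : nat) (s : F) : bool :=
  [forall j : 'I_i, hist_test h j s].

Lemma query_acceptsE (c : coins F r) s :
  query_accepts (run P f0 c) s
  = passed c r s && (ev (hist_f c r) (qpath dom s r) == sendC P c).
Proof. by []. Qed.

Lemma hist_f_take h i j : (j <= i)%N -> hist_f (take i h) j = hist_f h j.
Proof. by case: j => //= j ji; rewrite take_takel. Qed.

(** The first i tests involve only coins of earlier rounds, so they are fixed before the coin of
    round i is drawn. *)
Lemma passed_take h i s : passed (take i h) i s = passed h i s.
Proof.
apply: eq_forallb => -[j ji] /=; rewrite /hist_test !hist_f_take // 1?ltnW //.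
by rewrite take_takel ?nth_take // ltnW.
Qed.

Lemma passedS h i s : passed h i.+1 s = passed h i s && hist_test h i s.
Proof. exact: (forall_ordS (fun j => hist_test h j s)). Qed.

Let T := {x : F | x \in L dom 0}.

Definition hist_agree (h : seq (F * F)) (i : nat) (p : {poly F}) : nat :=
  #|[set t : T | passed h i (val t)
      && (ev (hist_f h i) (qpath dom (val t) i) == p.[qpath dom (val t) i])]|.

Variables (eps delta : R).
Hypothesis eps_gt0 : 0 < eps.
Hypothesis delta_gt0 : 0 < delta.

Let n : R := #|L dom 0|%:R.
Let d0 := (3 * 2 ^ r - 2)%N.
Let dstar : R := delta - 2 * r%:R * eps.
Let Lst := listsize (L dom 0) d0 dstar.
Let nustar : R := 2 * Lst%:R * ((d0%:R / #|F|%:R + eps) `^ (3^-1))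
                    + 4 / (eps ^+ 2 * #|F|%:R).
Hypothesis far : delta < codedist R f0 (RS (L dom 0) d0).

Lemma card_dom_gt0 : 0 < n.
Proof. by rewrite ltr0n; apply/card_gt0P; exists 0; apply: L_0. Qed.

Lemma far_reldist v : v \in RS (L dom 0) d0 -> delta < reldist R f0 v.
Proof.
move=> vRS; apply: lt_le_trans far _; rewrite /codedist.
by rewrite (bigD1 v) //= ge_min lexx.
Qed.

(** Otherwise every word would be a codeword, [f0] included, and its distance 0 to itself could not
    exceed [delta]. *)
Lemma deg_lt_card : (d0 < #|L dom 0|)%N.
Proof.
rewrite ltnNge; apply/negP => le.
have /far_reldist : f0 \in RS (L dom 0) d0.
  by rewrite in_set (leq_trans (size_interp _ _)).
rewrite /reldist (_ : [set x | _] = set0); last first.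
  by apply/setP => t; rewrite !inE eqxx.
by rewrite cards0 mul0r => /(lt_trans delta_gt0); rewrite ltxx.
Qed.

(** As a fraction of n, every threshold is at least 1 - [dstar], so one list size [Lst] serves all
    rounds. The bound holds at the start because [dstar] is at most [delta]. *)
Definition agree_bound (i : nat) : R := (1 - dstar + i%:R * eps) * n.

Definition hash_coef (e i : nat) (h : seq (F * F)) (t : T) : F :=
  (hash_poly (hist_f h i) (qpath dom (val t) i.+1))`_e.

Definition path_point (i : nat) (t : T) : F := qpath dom (val t) i.

(** The degree bound is one above that of f^(i+1): the relevant candidates are p (X - z) + B_z(x),
    that is, hashes before the quotient is taken. *)
Definition round_event (i : nat) (h : seq (F * F)) (z x : F) : bool :=
  deep_event (fun t : T => passed h i (val t))
    (hash_coef 0 i h)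
    (hash_coef 1 i h)
    (path_point i.+1)
    (deg_bound r i.+1).+1 (fun z => sendB P i h z : {poly F})
    (agree_bound i.+1) z x.

Lemma hash_poly_coef i (f : word (L dom i)) s x : (i < r)%N ->
  (hash_poly f s)`_0 + x * (hash_poly f s)`_1 = (hash_poly f s).[x].
Proof.
move=> ir; rewrite (horner_coef_wide _ (size_hash_poly f s ir)).
by rewrite !big_ord_recl big_ord0 /= expr0 expr1 mulr1 addr0 [x * _]mulrC.
Qed.

(** Composition with [qcomp] sends the close polynomials injectively to codewords on L^(0) at
    distance less than [dstar] from the pulled-back hash word [uu]. *)
Lemma close_listsize i h x : (i < r)%N ->
  (#|close (fun t : T => passed h i (val t))
    (hash_coef 0 i h)
    (hash_coef 1 i h)
    (path_point i.+1) (deg_bound r i.+1).+1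
    (agree_bound i.+1) x| <= Lst)%N.
Proof.
move=> ir.
pose uu : word (L dom 0) := [ffun t : T =>
  (hash_poly (hist_f h i) (qpath dom (val t) i.+1)).[x]].
pose vv (p : {poly_(deg_bound r i.+1).+1 F}) : word (L dom 0) :=
  [ffun t : T => (val p \Po qcomp dom i.+1).[val t]].
have sv (p : {poly_(deg_bound r i.+1).+1 F}) :
    (size (val p \Po qcomp dom i.+1)%R <= d0)%N.
  move: (qcomp dom i.+1) (size_qcomp dom ir) => Q sQ.
  have := size_comp_poly (val p) Q; rewrite sQ /= => e.
  have sp : ((size (val p)).-1 <= deg_bound r i.+1)%N.
    by have := size_npoly p; case: (size _).
  have : ((size (val p \Po Q)%R).-1 <= deg_bound r i.+1 * 2 ^ i.+1)%N.
    by rewrite e leq_mul2r sp orbT.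
  (* The composite has degree at most 3 * 2^r - 2 * 2^(i+1). As 2 * 2^(i+1) >= 4, there is room for
     the size, which is one more. *)
  have -> : (deg_bound r i.+1 * 2 ^ i.+1 = 3 * 2 ^ r - 2 * 2 ^ i.+1)%N.
    by rewrite /deg_bound mulnBl -mulnA -expnD subnK.
  have : (2 ^ i.+1 <= 2 ^ r)%N by rewrite leq_exp2l.
  have : (1 < 2 ^ i.+1)%N by rewrite -{1}(expn0 2) ltn_exp2l.
  rewrite /d0; move: (size _) (2 ^ i.+1)%N (2 ^ r)%N => m e1 e2. by lia.
(* The composites are determined by their values on L^(0), and composing with the nonconstant
   [qcomp] is injective. *)
have vvinj : injective vv.
  move=> p p' /ffunP e; apply: val_inj => /=.
  have : val p \Po qcomp dom i.+1 = val p' \Po qcomp dom i.+1.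
    apply: (@poly_agree _ (L dom 0) _ _ d0 (ltnW deg_lt_card)) => // y yL.
    by have := e (Sub y yL); rewrite !ffunE.
  move/eqP; rewrite -subr_eq0 -comp_polyB comp_poly_eq0 ?subr_eq0 => [/eqP//|].
  by rewrite size_qcomp // ltnS expn_gt0.
apply: (@leq_trans #|[set v in RS (L dom 0) d0 | (reldist R uu v < dstar)%R]|);
  last exact: (@leq_bigmax _ (fun u =>
    #|[set v in RS (L dom 0) d0 | (reldist R u v < dstar)%R]|) uu).
rewrite -(card_imset _ vvinj); apply: subset_leq_card.
apply/subsetP => _ /imsetP[p pc ->]; rewrite in_set in pc.
rewrite in_set RS_poly ?sv ?(ltnW deg_lt_card) //=.
rewrite /reldist ltr_pdivrMr ?card_dom_gt0 //.
have le : (agree (fun t : T => passed h i (val t))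
    (hash_coef 0 i h)
    (hash_coef 1 i h)
    (path_point i.+1) x (val p)
    <= #|[set t | fun_of_fin uu t == fun_of_fin (vv p) t]|)%N.
  apply: subset_leq_card; apply/subsetP => t; rewrite !in_set => /andP[_].
  by rewrite /hash_coef hash_poly_coef // !ffunE horner_comp qcompE.
have := card_agree_disagree uu (vv p).
move/(congr1 (fun m => m%:R : R)); rewrite natrD -/n => e.
have {}pc := lt_le_trans pc (_ : _ <= #|[set t | fun_of_fin uu t == fun_of_fin (vv p) t]|%:R).
rewrite ler_nat in pc; have {pc} := pc le.
have : 0 <= i.+1%:R * eps * n by rewrite !mulr_ge0 // ltW // card_dom_gt0.
by rewrite /agree_bound mulrDl mulrBl mul1r; lra.
Qed.

Lemma nustar_ge0 : 0 <= nustar.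
Proof.
apply: addr_ge0; first by rewrite !mulr_ge0 ?powR_ge0.
by rewrite divr_ge0 // mulr_ge0 // sqr_ge0.
Qed.

(* v(q(X)) + X w(q(X)) agrees with f^(i) wherever the two coefficients of the
   hash polynomial of f^(i) agree with v and w. *)
Lemma round_event_prob i h : (i < r)%N ->
  (forall p : {poly F}, (size p <= deg_bound r i)%N ->
     (hist_agree h i p)%:R <= agree_bound i) ->
  #|[set zx : F * F | round_event i h zx.1 zx.2]|%:R <= nustar * #|F|%:R ^+ 2.
Proof.
move=> ir IH; rewrite leNgt; apply/negP => big.
have q0 : (0 : R) < #|F|%:R by rewrite ltr0n; apply/card_gt0P; exists 0.
have q20 : (0 : R) < #|F|%:R ^+ 2 by rewrite exprn_gt0.
(* The event has at most q^2 members, so [big] forces [nustar] < 1. This yields the side conditions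
   eps < 1 and 4 <= eps^2 q of [deep_line_agree]. *)
have nu1 : nustar < 1.
  rewrite -(ltr_pM2r q20) mul1r; apply: lt_le_trans big _.
  by rewrite -natrX ler_nat; apply: leq_trans (max_card _) _; rewrite card_prod.
(* A nonempty event provides a close polynomial; [Lst] >= 1 then bounds [kap] by [nustar]. *)
have L1 : (0 < Lst)%N.
  have : (0 < #|[set zx : F * F | round_event i h zx.1 zx.2]|)%N.
    rewrite -(ltr_nat R); apply: le_lt_trans big.
    by rewrite mulr_ge0 ?nustar_ge0 // ltW.
  case/card_gt0P => -[z x]; rewrite in_set => /existsP[p /andP[pc _]].
  by apply: leq_trans (close_listsize h x ir); apply/card_gt0P; exists p.
(* Chosen so that kap^3 q = 8 (d0 + eps q), the shape of [kappa_cube]; [Lst] times [kap] is the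
   first term of [nustar]. *)
set kap : R := 2 * ((d0%:R / #|F|%:R + eps) `^ (3^-1)).
have base0 : 0 <= d0%:R / #|F|%:R + eps :> R.
  by rewrite addr_ge0 ?divr_ge0 // ltW.
have kap3 : kap ^+ 3 = 8 * (d0%:R / #|F|%:R + eps).
  by rewrite /kap exprMn cube_root //; ring.
have kap0 : 0 <= kap by rewrite mulr_ge0 ?powR_ge0.
have e0 : 0 <= 4 / (eps ^+ 2 * #|F|%:R) :> R.
  by rewrite divr_ge0 // mulr_ge0 // sqr_ge0.
have kapnu : Lst%:R * kap <= nustar by rewrite /nustar /kap; lra.
have kap1 : kap < 1.
  apply: le_lt_trans nu1; apply: le_trans kapnu.
  by rewrite ler_peMl // ler1n.
have eps1 : eps < 1.
  have : kap ^+ 3 <= 1 by rewrite exprn_ile1 // ltW.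
  have : 0 <= d0%:R / #|F|%:R :> R by rewrite divr_ge0.
  by rewrite kap3; lra.
have ql : 4 <= eps ^+ 2 * #|F|%:R.
  have : 4 / (eps ^+ 2 * #|F|%:R) <= 1.
    have : 0 <= Lst%:R * kap by rewrite mulr_ge0.
    by move: nu1; rewrite /nustar /kap; lra.
  by rewrite ler_pdivrMr ?mul1r // mulr_gt0 // exprn_gt0.
have kapd : 8 * ((deg_bound r i.+1).+1%:R + eps * #|F|%:R) <= kap ^+ 3 * #|F|%:R.
  have -> : kap ^+ 3 * #|F|%:R = 8 * (d0%:R + eps * #|F|%:R).
    by rewrite kap3; field; rewrite lt0r_neq0.
  rewrite ler_pM2l // lerD2r ler_nat.
  by rewrite -[d0]/(3 * 2 ^ r - 2)%N -[r in (2 ^ r)%N](subn0 r) deg_bound_lt.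
have evl : Lst%:R * kap * #|F|%:R ^+ 2
    < #|[set zx : F * F | round_event i h zx.1 zx.2]|%:R.
  by apply: le_lt_trans big; rewrite ler_pM2r.
have [c0 [c1 [s0 s1]]] := deep_line_agree (fun x => close_listsize h x ir)
  (fun z => size_npoly (sendB P i h z)) eps_gt0 eps1 ql kap0 kapd evl.
have -> : agree_bound i.+1 - eps * #|{: T}|%:R = agree_bound i.
  by rewrite card_word_dom /agree_bound -/n -natr1; ring.
apply/negP; rewrite -leNgt.
pose p := (c0 \Po q dom i) + 'X * (c1 \Po q dom i).
have sp : (size p <= deg_bound r i)%N.
  rewrite deg_boundS // /p; apply: leq_trans (size_polyD _ _) _.
  rewrite geq_max (leq_trans (size_comp_q dom ir s0)) ?mulnS ?add2n //=.
  rewrite mulrC; apply: leq_trans (size_polyMleq _ _) _.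
  by rewrite size_polyX addn2 /= ltnS size_comp_q.
apply: le_trans (IH p sp); rewrite ler_nat; apply: subset_leq_card.
apply/subsetP => t; rewrite !in_set => /and3P[-> /eqP e0' /eqP e1'] /=.
have yL : qpath dom (val t) i \in L dom i.
  by apply: qpath_L; [exact: (valP t) | exact: ltnW].
rewrite -(hash_polyE (hist_f h i) yL) -hash_poly_coef //.
rewrite /hash_coef /path_point /= in e0' e1'.
by rewrite e0' e1' /p !(hornerD, hornerM, hornerX, horner_comp).
Qed.

Lemma round_event_take i h z x :
  round_event i (take i h) z x =
  deep_event (fun t : T => passed h i (val t)) (hash_coef 0 i h)
    (hash_coef 1 i h) (path_point i.+1) (deg_bound r i.+1).+1
    (fun z => sendB P i (take i h) z : {poly F}) (agree_bound i.+1) z x.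
Proof.
have eW : (fun t : T => passed (take i h) i (val t)) = (fun t : T => passed h i (val t)).
  by apply: funext => t; rewrite passed_take.
have ec e : hash_coef e i (take i h) = hash_coef e i h.
  by apply: funext => t; rewrite /hash_coef hist_f_take.
by rewrite /round_event eW !ec.
Qed.

Lemma hist_agree_take i h p : hist_agree (take i h) i p = hist_agree h i p.
Proof.
by apply: eq_card => t; rewrite !in_set passed_take hist_f_take.
Qed.

(** The first conjunct empties the event for histories that already violate the agreement bound, so
    its probability is small whatever the history. *)
Definition bad_round (i : nat) (h : seq (F * F)) (zx : F * F) : bool :=
  `[< forall p : {poly F}, (size p <= deg_bound r i)%N ->
        (hist_agree h i p)%:R <= agree_bound i >]
  && round_event i h zx.1 zx.2.

Lemma bad_round_prob i : (i < r)%N ->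
  #|[set c : coins F r | bad_round i (take i c) (nth (0, 0) c i)]|%:R
    <= nustar * #|{: coins F r}|%:R.
Proof.
move=> ir; apply: card_fresh_coin => // h; rewrite /bad_round.
case: asboolP => [IH|_] /=.
  by rewrite card_prod natrM; apply: round_event_prob.
rewrite (_ : [set _ | false] = set0) ?cards0 ?mulr_ge0 ?nustar_ge0 //.

Qed.

Definition bad_coins : {set coins F r} :=
  \bigcup_(i < r) [set c : coins F r | bad_round i (take i c) (nth (0, 0) c i)].

Lemma bad_coins_prob :
  #|bad_coins|%:R <= r%:R * nustar * #|{: coins F r}|%:R.
Proof.
apply: (@le_trans _ _ (\sum_(i < r) #|[set c : coins F r |
    bad_round i (take i c) (nth (0, 0) c i)]|%:R)).
  rewrite -natr_sum ler_nat /bad_coins.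
  elim/big_rec2: _ => [|i m A _ le]; first by rewrite cards0.
  by rewrite (leq_trans (leq_card_setU _ _)) // leq_add2l.
apply: (@le_trans _ _ (\sum_(i < r) nustar * #|{: coins F r}|%:R)).
  by apply: ler_sum => i _; apply: bad_round_prob.
by rewrite sumr_const card_ord -[_ *+ _]mulr_natl mulrA.
Qed.

Lemma hist_agree0 h (p : {poly F}) : (size p <= deg_bound r 0)%N ->
  (hist_agree h 0 p)%:R <= agree_bound 0.
Proof.
rewrite /deg_bound subn0 => sp.
pose v : word (L dom 0) := [ffun t => p.[val t]].
have := far_reldist (RS_poly (ltnW deg_lt_card) sp).
rewrite -/v /reldist ltr_pdivlMr ?card_dom_gt0 //.
have := card_agree_disagree f0 v.
have -> : #|[set t | fun_of_fin f0 t == fun_of_fin v t]| = hist_agree h 0 p.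
  apply: eq_card => t; rewrite !in_set /= ev_val ffunE.
  by rewrite (_ : passed h 0 (val t)) //; apply/forallP => -[].
move/(congr1 (fun m => m%:R : R)); rewrite natrD -/n => e.
have : 0 <= 2 * r%:R * eps * n.
  by rewrite !mulr_ge0 // ltW // card_dom_gt0.
rewrite /agree_bound /dstar mul0r addr0.
by lra.
Qed.

(** If some [p] violated the bound after round i, then [p'] = p (X - z) + B_z(x) would undo the
    quotient: it agrees with the hash wherever the test passed and f^(i+1) agrees with [p], and its
    value at z is B_z(x). Round i would then be bad. *)
Lemma good_coins_agree (c : coins F r) : c \notin bad_coins ->
  forall i, (i <= r)%N -> forall p : {poly F}, (size p <= deg_bound r i)%N ->
  (hist_agree c i p)%:R <= agree_bound i.
Proof.
move=> good; elim=> [_|i IH ir] p sp; first exact: hist_agree0.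
have {}IH := IH (ltnW ir).
have : ~~ bad_round i (take i c) (nth (0, 0) c i).
  apply: contra good => b; apply/bigcupP; exists (Ordinal ir) => //.
  by rewrite in_set.
rewrite negb_and => /orP[/asboolPn[]|]; first by move=> p' sp'; rewrite hist_agree_take; apply: IH.
rewrite round_event_take => ne; rewrite leNgt; apply/negP => lt.
move/negP: ne; apply.
set z := (nth (0, 0) c i).1; set x := (nth (0, 0) c i).2.
pose p' := p * ('X - z%:P) + ((sendB P i (take i c) z : {poly F}).[x])%:P.
have sp' : (size p' <= (deg_bound r i.+1).+1)%N.
  apply: leq_trans (size_polyD _ _) _; rewrite geq_max.
  rewrite (leq_trans (size_polyMleq _ _)) ?size_XsubC ?addn2 //=.
  by rewrite (leq_trans (size_polyC_leq1 _)).
apply/existsP; exists (NPoly sp'); rewrite in_set /=; apply/andP; split; last first.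
  by rewrite /p' !hornerE subrr mulr0 add0r.
apply: lt_le_trans lt _; rewrite ler_nat; apply: subset_leq_card.
apply/subsetP => t; rewrite !in_set passedS => /andP[/andP[-> h1] /eqP h2] /=.
have yL : qpath dom (val t) i.+1 \in L dom i.+1.
  by apply: qpath_L; [exact: (valP t) | exact: ir].
move/eqP: h1; rewrite ev_hash // h2 -/z -/x => h1.
rewrite /hash_coef hash_poly_coef // h1 /path_point /p'.
by rewrite hornerD hornerM hornerXsubC hornerC.
Qed.

Variables (l : nat) (logn : R).
Hypothesis logn_ge : r%:R <= logn.
Let errQ : R := (1 - dstar + logn * eps) ^+ l.

(** The default value 1 of the minimum caps [codedist]. *)
Lemma delta_lt1 : delta < 1.
Proof.
apply: lt_le_trans far _; rewrite /codedist.
by elim/big_rec: _ => // v x _ x1; rewrite ge_min x1 orbT.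
Qed.

Lemma err_base_ge0 : 0 <= 1 - dstar + logn * eps.
Proof.
have : 0 <= logn * eps.
  by rewrite mulr_ge0 ?(ltW eps_gt0) // (le_trans _ logn_ge).
have : 0 <= 2 * r%:R * eps by rewrite !mulr_ge0 // ltW.
by have := delta_lt1; rewrite /dstar; lra.
Qed.

Lemma good_coins_accept (c : coins F r) : c \notin bad_coins ->
  Pr R [pred s : queries dom l | accepts (run P f0 c) s] <= errQ.
Proof.
move=> good; rewrite Pr_accepts /errQ.
apply: lerXn2r; rewrite ?nnegrE ?err_base_ge0 ?divr_ge0 //.
rewrite ler_pdivrMr ?card_dom_gt0 //.
(* At accepting points the last oracle agrees with the constant [sendC P c], which meets the final
   degree bound 1. *)
apply: (@le_trans _ _ (hist_agree c r (sendC P c)%:P)%:R).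
  rewrite ler_nat; apply: subset_leq_card; apply/subsetP => t.
  by rewrite !in_set query_acceptsE hornerC.
apply: le_trans (good_coins_agree good (leqnn r) _) _.
  by rewrite /deg_bound subnn expn0 size_polyC_leq1.
rewrite /agree_bound ler_pM2r ?card_dom_gt0 // lerD2l.
by rewrite ler_wpM2r // ltW.
Qed.

Lemma coins_gt0 : (0 : R) < #|{: coins F r}|%:R.
Proof. by rewrite ltr0n; apply/card_gt0P; exists [tuple (0, 0) | i < r]. Qed.

Lemma commit_soundness :
  Pr R [pred c : coins F r |
    errQ < Pr R [pred s : queries dom l | accepts (run P f0 c) s]]
  <= r%:R * nustar.
Proof.
rewrite {1}/Pr ler_pdivrMr ?coins_gt0 //; apply: le_trans bad_coins_prob.
rewrite ler_nat; apply: subset_leq_card; apply/subsetP => c.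
rewrite inE; apply: contraTT => good.
by rewrite -leNgt; apply: good_coins_accept.
Qed.

(** Acceptance is averaged over the coins, with the trivial bound 1 on bad coins and [errQ] on the
    others. *)
Lemma total_soundness :
  Pr R [pred cs : coins F r * queries dom l | accepts (run P f0 cs.1) cs.2]
  <= r%:R * nustar + errQ.
Proof.
have Q0 : (0 : R) < #|{: queries dom l}|%:R.
  rewrite ltr0n; apply/card_gt0P.
  by exists [ffun=> exist _ 0 (L_0 dom 0)].
rewrite /Pr card_prod natrM ler_pdivrMr ?mulr_gt0 ?coins_gt0 //.
have -> : #|[pred cs : coins F r * queries dom l | accepts (run P f0 cs.1) cs.2]|%:R
    = \sum_(c : coins F r) Pr R [pred s : queries dom l | accepts (run P f0 c) s]
        * #|{: queries dom l}|%:R :> R.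
  under [RHS]eq_bigr do rewrite /Pr divfK ?lt0r_neq0 //.
  rewrite -natr_sum; congr (_%:R); rewrite -sum1_card big_mkcond /=.
  under [RHS]eq_bigr do rewrite -sum1_card big_mkcond /=.
  by rewrite pair_bigA; apply: eq_bigr => -[c s] _.
apply: (@le_trans _ _ (\sum_(c : coins F r)
    ((c \in bad_coins)%:R + errQ) * #|{: queries dom l}|%:R)).
  apply: ler_sum => c _; rewrite ler_pM2r //.
  case: (boolP (c \in bad_coins)) => [_|good].
    by rewrite (le_trans (Pr_le1 _ _)) // lerDl exprn_ge0 // err_base_ge0.
  by rewrite add0r; apply: good_coins_accept.
rewrite -mulr_suml mulrA ler_pM2r // big_split /= sumr_const -[_ *+ _]mulr_natr.
rewrite mulrDl lerD2r; apply: le_trans bad_coins_prob.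
rewrite -sum1_card natr_sum [leRHS]big_mkcond /=.
by apply: ler_sum => c _; case: (c \in _).
Qed.

End Soundness.

(** * Completeness *)

Lemma log2_card_dom (R : realType) (F : finFieldType) (ch2 : 2%N \in [pchar F])
    (k r : nat) (dom : domains ch2 k r) :
  log2 #|L dom 0|%:R = k%:R :> R.
Proof.
rewrite /log2 card_L // subn0 natrX lnXn // -[ln _ *+ k]mulr_natl mulfK //.
by rewrite lt0r_neq0 // ln_gt0 // ltr1n.
Qed.

(** This comes from the q-adic expansion of [p]: a remainder modulo [q] has degree at most 1, and
    its two coefficients become the constant terms of [a] and [b]. *)
Lemma poly_split (F : fieldType) (q p : {poly F}) (m : nat) :
  size q = 3%N -> (size p <= 2 * m)%N ->
  exists a b : {poly F}, [/\ (size a <= m)%N, (size b <= m)%N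
    & p = (a \Po q) + 'X * (b \Po q)].
Proof.
move=> sq; elim: m p => [|m IH] p sp.
  exists 0, 0; rewrite size_poly0 comp_poly0 mulr0 addr0; split=> //.
  by apply/eqP; rewrite -size_poly_leq0.
have q0 : q != 0 by rewrite -size_poly_eq0 sq.
have sd : (size (p %/ q)%R <= 2 * m)%N by rewrite size_divp // sq /= leq_subLR -mulnS.
have [a [b [sa sb e]]] := IH _ sd.
have sm : (size (p %% q)%R <= 2)%N by rewrite -ltnS -sq ltn_modp.
have sX (c : {poly F}) (x : F) : (size c <= m)%N -> (size (c * 'X + x%:P)%R <= m.+1)%N.
  by move=> sc; rewrite size_MXaddC; case: ifP.
exists (a * 'X + ((p %% q)`_0)%:P), (b * 'X + ((p %% q)`_1)%:P).
split; rewrite ?sX //.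
rewrite !comp_polyD !comp_polyM !comp_polyX !comp_polyC {1}(divp_eq p q) {1}e.
have -> : p %% q = ((p %% q)`_0)%:P + 'X * ((p %% q)`_1)%:P.
  apply/polyP => i; rewrite coefD coefC coefXM coefC.
  case: i => [|[|i]] /=; rewrite ?addr0 ?add0r // nth_default //.
  exact: leq_trans sm _.
move: ((p %% q)`_0) ((p %% q)`_1) => u v; rewrite !coefD !coefC /= !coefXM !coefC /= addr0 add0r.
by ring.
Qed.

Section Completeness.

Context (F : finFieldType) (ch2 : 2%N \in [pchar F]) (k r : nat).
Variables (dom : domains ch2 k r).

Lemma card_q_fibre i s : (i < r)%N -> s \in L dom i.+1 ->
  #|[set y in L dom i | (q dom i).[y] == s]| = 2%N.
Proof.
move=> ir; rewrite image_q // => /imsetP[y yL ->].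
have [w w0 E] := L0_pair dom ir.
rewrite (q_fibre ir w0 E yL) cards2.
by rewrite -{1}[y]addr0 (inj_eq (addrI y)) eq_sym w0.
Qed.

(** If f = a(q) + X b(q), then on the fibre over s it is the line a(s) + X b(s), so the hash is a +
    x b, with half the size. *)
Lemma size_interp_hash i (f : word (L dom i)) x m : (i < r)%N ->
  (size (interp (L dom i) (ev f)) <= 2 * m)%N ->
  (size (interp (L dom i.+1) (ev (hash x f))) <= m)%N.
Proof.
move=> ir sf; have [a [b [sa sb e]]] := poly_split (size_q dom ir) sf.
(* If [m] exceeds the size of the domain, interpolation alone gives the bound. *)
case: (leqP m #|L dom i.+1|) => [mL|/ltnW]; last exact: leq_trans (size_interp _ _).
have sab : (size (a + x *: b)%R <= m)%N.
  apply: leq_trans (size_polyD _ _) _; rewrite geq_max sa.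
  exact: leq_trans (size_scale_leq _ _) _.
rewrite (@interp_uniq _ _ _ (a + x *: b)) ?(leq_trans sab) // => s sL.
rewrite ev_hash // /hash_poly.
rewrite (@interp_uniq _ _ _ (a.[s]%:P + b.[s] *: 'X)).
- by rewrite !(hornerD, hornerZ, hornerC, hornerX) mulrC.
- rewrite card_q_fibre //; apply: leq_trans (size_polyD _ _) _.
  rewrite geq_max (leq_trans (size_polyC_leq1 _)) //=.
  by rewrite (leq_trans (size_scale_leq _ _)) ?size_polyX.
move=> y; rewrite in_set => /andP[yL /eqP <-].
rewrite -(interpE (ev f) yL) e.
by rewrite !(hornerD, hornerZ, hornerC, hornerX, hornerM, horner_comp) mulrC.
Qed.

(** Away from z this is exact division of G - G(z) by X - z, and at z it is the convention built
    into [quotient]; so one polynomial describes the whole word. *)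
Lemma quotient_poly (D : {set F}) (g : word D) (z : F) :
  let G := interp D (ev g) in
  let Q := (G - G.[z]%:P) %/ ('X - z%:P) in
  [/\ G = Q * ('X - z%:P) + G.[z]%:P, (size Q <= (size G).-1)%N
    & {in D, forall y, ev (Defs.quotient g z G.[z]) y = Q.[y]}].
Proof.
move=> G Q.
have eG : G = Q * ('X - z%:P) + G.[z]%:P.
  by rewrite divpK ?subrK // dvdp_XsubCl rootE !hornerE subrr.
split=> //.
  rewrite size_divp ?polyXsubC_eq0 // size_XsubC /= subn1.
  have : (size (G - G.[z]%:P)%R <= maxn (size G) 1)%N.
    apply: leq_trans (size_polyD _ _) _; rewrite size_polyN geq_max leq_maxl.
    by rewrite (leq_trans (size_polyC_leq1 _)) ?leq_maxr.
  case: (posnP (size G)) => [/eqP|G0].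
    by rewrite size_poly_eq0 => /eqP->; rewrite horner0 subrr size_poly0.
  by rewrite (maxn_idPl G0); move: (size _) (size _) => a b; lia.
move=> y yD; rewrite /ev insubT ffunE /=.
case: eqVneq => [-> //|yz] /=.
rewrite -(interpE (ev g) yD) -/G {1}eG.
by rewrite hornerD hornerM hornerXsubC hornerC addrK mulfK // subr_eq0.
Qed.

Lemma quotientK (D : {set F}) (g : word D) (z y : F) : y \in D ->
  ev (Defs.quotient g z (interp D (ev g)).[z]) y * (y - z) + (interp D (ev g)).[z]
  = ev g y.
Proof.
move=> yD; have [eG _ ->//] := quotient_poly g z.
by rewrite -[RHS](interpE (ev g) yD) [in RHS]eG hornerD hornerM hornerXsubC hornerC.
Qed.

Lemma size_interp_quotient (D : {set F}) (g : word D) (z : F) :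
  (size (interp D (ev (Defs.quotient g z (interp D (ev g)).[z])))
    <= (size (interp D (ev g))).-1)%N.
Proof.
have [_ sQ eQ] := quotient_poly g z.
rewrite (interp_uniq _ (fun y yD => esym (eQ y yD))) //.
exact: leq_trans sQ (leq_trans (leq_pred _) (size_interp _ _)).
Qed.

Variable f0 : word (L dom 0).

Lemma honestfS h i :
  honestf f0 h i.+1 =
  Defs.quotient (hash (nth (0, 0) h i).2 (honestf f0 h i)) (nth (0, 0) h i).1
    (honestB (honestf f0 h i) (nth (0, 0) h i).1).[(nth (0, 0) h i).2].
Proof. by rewrite /=; case: (nth _ _ _). Qed.

Lemma honestf_take h i j : (j <= i)%N -> honestf f0 (take i h) j = honestf f0 h j.
Proof.
elim: j => // j IH ji; rewrite !honestfS nth_take // IH //.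
exact: ltnW.
Qed.

Lemma tf_honest (c : coins F r) i : tf (run (honest f0) f0 c) i = honestf f0 c i.
Proof. by case: i => //= i; exact: (honestf_take _ (leqnn i.+1)). Qed.

Lemma tB_honest (c : coins F r) i :
  tB (run (honest f0) f0 c) i = honestB (honestf f0 c i) (nth (0, 0) c i).1.
Proof. by rewrite /= honestf_take. Qed.

Lemma size_honestf h i : f0 \in RS (L dom 0) (deg_bound r 0) -> (i <= r)%N ->
  (size (interp (L dom i) (ev (honestf f0 h i))) <= deg_bound r i)%N.
Proof.
rewrite in_set => s0; elim: i => [//|i IH] ir.
rewrite honestfS honestB_spec //.
apply: leq_trans (size_interp_quotient _ _) _.
rewrite -ltnS; have : (size (interp (L dom i.+1)
    (ev (hash (nth (0%R, 0%R) h i).2 (honestf f0 h i)))) <= (deg_bound r i.+1).+1)%N.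
  by apply: size_interp_hash => //; rewrite -deg_boundS // IH // ltnW.
by case: (size _).
Qed.

Lemma honest_accepts (c : coins F r) s :
  f0 \in RS (L dom 0) (deg_bound r 0) -> s \in L dom 0 ->
  query_accepts (run (honest f0) f0 c) s.
Proof.
move=> f0RS sL; apply/andP; split.
  apply/forallP => -[i ir]; rewrite !tf_honest tB_honest honestfS.
  rewrite honestB_spec // quotientK //.
  exact: (qpath_L sL ir).
rewrite tf_honest /=.
(* The last oracle is constant, and the honest [C] is its value at 0, which lies in L^(r). *)
have := size_honestf c f0RS (leqnn r).
rewrite /deg_bound subnn expn0 => /size1_polyC e.
have yL : qpath dom s r \in L dom r := qpath_L sL (leqnn r).
by rewrite -(interpE (ev _) yL) -(interpE (ev _) (L_0 dom r)) e !hornerC.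
Qed.

Lemma completeness (R : realType) l : f0 \in RS (L dom 0) (deg_bound r 0) ->
  Pr R [pred cs : coins F r * queries dom l |
          accepts (run (honest f0) f0 cs.1) cs.2] = 1.
Proof.
move=> f0RS; rewrite /Pr.
have -> : #|[pred cs : coins F r * queries dom l |
    accepts (run (honest f0) f0 cs.1) cs.2]| = #|{: coins F r * queries dom l}|.
  apply: eq_card => -[c s]; rewrite !inE /=.
  by apply/forallP => j; apply: honest_accepts; last exact: (valP (s j)).
rewrite mulfV // lt0r_neq0 // ltr0n; apply/card_gt0P.
by exists ([tuple (0, 0) | i < r], [ffun=> exist _ 0 (L_0 dom 0)]).
Qed.

End Completeness.

(** * The verifier program *)

Section Programs.

Variable F : fieldType.
Implicit Types (m : nat -> F) (p : prog F) (orc : nat -> F -> F).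

(** Unrolled, with index 0 executed first; the constants and registers of a body may depend on its
    index. *)
Fixpoint loop (body : nat -> prog F) (n : nat) : prog F :=
  if n is j.+1 then Then (loop body j) (body j) else Nop F.

Definition block (s : seq (prog F)) : prog F := foldr (@Then F) (Nop F) s.

Fixpoint step orc m p : nat -> F :=
  match p with
  | Then p1 p2 => step orc (step orc m p1) p2
  | Const d c => write m d c
  | Arith d o i j => write m d (arith_sem o (m i) (m j))
  | IfZero i p1 p2 => if m i == 0 then step orc m p1 else step orc m p2
  | Query d t i => write m d (orc t (m i))
  | _ => m
  end.

Fixpoint cost p : nat :=
  match p with
  | Then p1 p2 => cost p1 + cost p2
  | Const _ _ | Arith _ _ _ _ => 1
  | IfZero _ p1 p2 => (maxn (cost p1) (cost p2)).+1
  | _ => 0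
  end.

Fixpoint queries_of p : nat :=
  match p with
  | Then p1 p2 => queries_of p1 + queries_of p2
  | IfZero _ p1 _ => queries_of p1
  | Query _ _ _ => 1
  | _ => 0
  end.

(* No interaction, and a number of queries that does not depend on the tests. *)
Fixpoint silent p : bool :=
  match p with
  | Then p1 p2 => silent p1 && silent p2
  | IfZero _ p1 p2 => [&& silent p1, silent p2 & queries_of p1 == queries_of p2]
  | Recv _ | Send _ => false
  | _ => true
  end.

(** Separates the registers, given by [step], from the counters: the number of queries is exact,
    while branching leaves only an upper bound on the operations. *)
Lemma exec_silent orc p m ib tr n k : silent p ->
  exists2 n', (n' <= n + cost p)%N &
    exec orc p (State m ib tr n k)
    = State (step orc m p) ib tr n' (k + queries_of p).
Proof.
elim: p m n k => //=.
- by move=> m n k _; exists n; rewrite ?addn0.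
- move=> p1 IH1 p2 IH2 m n k /andP[/IH1 h1 /IH2 h2].
  have [n1 l1 ->] := h1 m n k; have [n2 l2 ->] := h2 (step orc m p1) n1 (k + queries_of p1)%N.
  by exists n2; rewrite ?addnA // (leq_trans l2) // leq_add2r.
- by move=> d a m n k _; exists n.+1; rewrite ?addn1 ?addn0.
- by move=> d o i j m n k _; exists n.+1; rewrite ?addn1 ?addn0.
- move=> i p1 IH1 p2 IH2 m n k /and3P[/IH1 h1 /IH2 h2 /eqP e].
  case: ifP => _.
    have [n' l ->] := h1 m n.+1 k; exists n' => //.
    by rewrite (leq_trans l) // addSnnS leq_add2l ltnS leq_maxl.
  have [n' l ->] := h2 m n.+1 k; exists n'; last by rewrite e.
  by rewrite (leq_trans l) // addSnnS leq_add2l ltnS leq_maxr.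
- by move=> d t i m n k _; exists n; rewrite ?addn0 ?addn1.
Qed.

Lemma step_loop orc body (I : nat -> (nat -> F) -> Prop) N m :
  (forall j mj, (j < N)%N -> I j mj -> I j.+1 (step orc mj (body j))) ->
  I 0%N m -> I N (step orc m (loop body N)).
Proof.
move=> hb I0; elim: N hb => [//|N IH] hb /=.
by apply: (hb) => //; apply: IH => j mj jN; apply/hb/ltnW.
Qed.

Lemma cost_loop body N c : (forall j, (cost (body j) <= c)%N) ->
  (cost (loop body N) <= N * c)%N.
Proof. by move=> h; elim: N => //= N IH; rewrite mulSnr leq_add ?h. Qed.

Lemma queries_loop body N c : (forall j, queries_of (body j) = c) ->
  queries_of (loop body N) = (N * c)%N.
Proof. by move=> h; elim: N => //= N ->; rewrite mulSnr h. Qed.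

Lemma silent_loop body N : (forall j, silent (body j)) -> silent (loop body N).
Proof. by move=> h; elim: N => //= N ->; apply: h. Qed.

Lemma step_block orc m p s : step orc m (block (p :: s)) = step orc (step orc m p) (block s).
Proof. by []. Qed.

Lemma step_arith orc m d o i j :
  step orc m (Arith F d o i j) = write m d (arith_sem o (m i) (m j)).
Proof. by []. Qed.

Lemma step_const orc m d a : step orc m (Const d a) = write m d a.
Proof. by []. Qed.

Lemma step_query orc m d t i : step orc m (Query F d t i) = write m d (orc t (m i)).
Proof. by []. Qed.

Lemma step_ifzero orc m i p1 p2 : step orc m (IfZero i p1 p2) =
  if m i == 0 then step orc m p1 else step orc m p2.
Proof. by []. Qed.

Lemma step_nop orc m : step orc m (Nop F) = m.
Proof. by []. Qed.

Lemma write_same m d a : write m d a d = a.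
Proof. by rewrite /write eqxx. Qed.

Lemma write_neq m d a i : i != d -> write m d a i = m i.
Proof. by rewrite /write => /negbTE->. Qed.

End Programs.

Lemma nth_flatten_blocks (T : Type) (x0 : T) (b : nat -> seq T) (w r s : nat)
    (tl : seq T) (i e : nat) :
  (forall j, size (b j) = w) -> (i < r)%N -> (e < w)%N ->
  nth x0 (flatten [seq b j | j <- iota s r] ++ tl) (w * i + e) = nth x0 (b (s + i)%N) e.
Proof.
move=> sb; elim: r s i => [//|r IH] s [|i] ir ew /=.
  by rewrite muln0 add0n -catA nth_cat sb ew addn0.
rewrite -catA nth_cat sb mulnS -addnA ltnNge leq_addr /= addKn IH //.
by rewrite addSnnS.
Qed.

Lemma size_flatten_blocks (T : Type) (b : nat -> seq T) (w r s : nat) :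
  (forall j, size (b j) = w) -> size (flatten [seq b j | j <- iota s r]) = (w * r)%N.
Proof.
move=> sb; elim: r s => [|r IH] s /=; first by rewrite muln0.
by rewrite size_cat sb IH mulnS.
Qed.

Ltac step_once lookup :=
  first [rewrite step_block step_arith | rewrite step_block step_const
        | rewrite step_block step_query]; repeat lookup.

(* Work register 0 is the failure flag, and register 0 holds s^(i). *)
Definition work_reg (r j : nat) : nat := (j + (4 * r + 2))%N.
Definition msg_reg (i e : nat) : nat := (4 * i + e.+1)%N.

Lemma work_reg_neq r j j' : j != j' -> work_reg r j != work_reg r j'.
Proof. by rewrite /work_reg eqn_add2r. Qed.

Lemma work_reg_neq0 r j : 0%N != work_reg r j.
Proof. by rewrite /work_reg; lia. Qed.

Lemma msg_reg_neq0 i e : msg_reg i e != 0%N.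
Proof. by rewrite /msg_reg; lia. Qed.

Lemma msg_work_neq r i e j : (i < r)%N -> (e < 4)%N -> msg_reg i e != work_reg r j.
Proof. by rewrite /msg_reg /work_reg; lia. Qed.

Ltac verifier_lookup := first
  [ rewrite write_same
  | rewrite write_neq; [|exact: work_reg_neq]
  | rewrite write_neq; [|exact: work_reg_neq0]
  | rewrite write_neq; [|rewrite eq_sym; exact: work_reg_neq0]
  | rewrite write_neq; [|exact: msg_reg_neq0]
  | rewrite write_neq; [|exact: msg_work_neq] ].

Section Verifier.

Context (F : finFieldType) (ch2 : 2%N \in [pchar F]) (k r : nat).
Variables (dom : domains ch2 k r).

(** The nonzero element of L0^(i), a constant of the programs; the default 0 does not occur for i <
    r. *)
Definition omega (i : nat) : F := odflt 0 [pick w in L0 dom i | w != 0].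

Lemma omegaP i : (i < r)%N -> omega i != 0 /\ L0 dom i = [set 0; omega i].
Proof.
move=> ir; have [w w0 E] := L0_pair dom ir; rewrite /omega.
case: pickP => [w'|/(_ w)]; last by rewrite E in_set2 eqxx orbT w0.
rewrite E in_set2 => /andP[/orP[/eqP->|/eqP-> _]]; first by rewrite eqxx.
by split.
Qed.

(** The interpolating line through the two roots y and y + [omega i], in the form that the verifier
    evaluates. *)
Lemma hash_omega i (f : word (L dom i)) x y : (i < r)%N -> y \in L dom i ->
  ev (hash x f) (y * (y + omega i))
  = (ev f (y + omega i) - ev f y) / omega i * (x - y) + ev f y.
Proof.
move=> ir yL; have [w0 E] := omegaP ir.
have qy := qE y w0 E; rewrite -qy ev_hash; last by rewrite image_q // imset_f.
set c := _ / _; rewrite /hash_poly (q_fibre ir w0 E yL).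
have ny : y != y + omega i by rewrite -{1}[y]addr0 (inj_eq (addrI y)) eq_sym.
rewrite (@interp_uniq _ _ _ (c *: ('X - y%:P) + (ev f y)%:P)).
- by rewrite hornerD hornerZ hornerXsubC hornerC.
- rewrite cards2 ny (leq_trans (size_polyD _ _)) // geq_max.
  rewrite (leq_trans (size_scale_leq _ _)) ?size_XsubC //.
  by rewrite (leq_trans (size_polyC_leq1 _)).
move=> z; rewrite in_set2 hornerD hornerZ hornerXsubC hornerC.
case/orP => /eqP->; first by rewrite subrr mulr0 add0r.
by rewrite addrAC subrr add0r /c divfK // subrK.
Qed.

(** [M 0] to [M 3] hold z, the two coefficients of B_z, and x. [W 4] receives the hash and finally
    the difference of the two sides of the test. Two queries serve the hash and a third one reads
    the next oracle. *)
Definition verifier_round (i : nat) : prog F :=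
  let W := work_reg r in let M := msg_reg i in
  block [:: Query F (W 1) i 0; Const (W 2) (omega i);
    Arith F (W 3) Add 0 (W 2); Query F (W 4) i (W 3);
    Arith F (W 4) Defs.Sub (W 4) (W 1); Arith F (W 4) Div (W 4) (W 2);
    Arith F (W 5) Defs.Sub (M 3) 0; Arith F (W 4) Mul (W 4) (W 5);
    Arith F (W 4) Add (W 4) (W 1); Arith F 0 Mul 0 (W 3);
    Query F (W 1) i.+1 0; Arith F (W 2) Defs.Sub 0 (M 0);
    Arith F (W 1) Mul (W 1) (W 2); Arith F (W 2) Mul (M 2) (M 3);
    Arith F (W 2) Add (M 1) (W 2);
    Arith F (W 1) Add (W 1) (W 2); Arith F (W 4) Defs.Sub (W 4) (W 1);
    IfZero (W 4) (Nop F) (Const (W 0) 1%R)]%N.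

(** The last branch moves the failure flag into register 0, where acceptance is read. *)
Definition verifier : prog F :=
  let W := work_reg r in
  block [:: Const (W 0) 0%R; loop verifier_round r;
    Query F (W 1) r 0; Arith F (W 1) Defs.Sub (W 1) (4 * r + 1);
    IfZero (W 1) (Nop F) (Const (W 0) 1%R);
    IfZero (W 0) (Const 0 0%R) (Const 0 1%R)]%N.

(** The messages are 4 r + 1 field elements, and each of the 3 r + 1 queries transmits two. *)
Lemma verifier_communication (t : transcript dom) : communication t (3 * r + 1) = (10 * r + 3)%N.
Proof.
rewrite /communication /messages size_cat (@size_flatten_blocks _ _ 4) //=.
by lia.
Qed.

Variables (t : transcript dom) (s : F).
Hypothesis sL : s \in L dom 0.

Definition round_test (i : nat) : bool :=
  ev (hash (tx t i) (tf t i)) (qpath dom s i.+1) ==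
  ev (tf t i.+1) (qpath dom s i.+1) * (qpath dom s i.+1 - tz t i)
    + (tB t i).[tx t i].

Definition verifier_inv (i : nat) (m : nat -> F) : Prop :=
  [/\ m 0 = qpath dom s i,
      forall j, (0 < j < 4 * r + 2)%N -> m j = nth 0 (s :: messages t) j
    & (m (work_reg r 0) == 0) = [forall j : 'I_i, round_test j]].

Let orc i := ev (tf t i).

Lemma poly_2E (p : {poly_2 F}) x : (p : {poly F}).[x] = p`_0 + p`_1 * x.
Proof.
rewrite (horner_coef_wide _ (size_npoly p)) !big_ord_recl big_ord0 /=.
by rewrite expr0 expr1 mulr1 addr0.
Qed.

Lemma verifier_roundP i m : (i < r)%N -> verifier_inv i m ->
  verifier_inv i.+1 (step orc m (verifier_round i)).
Proof.
move=> ir [m0 mm mb].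
have msg e : (e < 4)%N -> m (msg_reg i e)
    = nth 0 [:: tz t i; (tB t i)`_0; (tB t i)`_1; tx t i] e.
  move=> e4; rewrite mm; last by rewrite /msg_reg; lia.
  by rewrite /msg_reg addnS /= /messages nth_flatten_blocks.
have yL : qpath dom s i \in L dom i := qpath_L sL (ltnW ir).
have qy : qpath dom s i.+1 = qpath dom s i * (qpath dom s i + omega i).
  by have [w0 E] := omegaP ir; apply: qE.
have jW j a : (0 < j < 4 * r + 2)%N -> j != work_reg r a.
  by rewrite /work_reg; lia.
rewrite /verifier_round.
(* Otherwise unification unfolds the nested writes, at exponential cost. *)
Opaque write work_reg msg_reg.
do 17 step_once verifier_lookup.
rewrite step_block step_ifzero step_nop step_const.
repeat verifier_lookup.
have mz : m (msg_reg i 0) = tz t i := msg 0 isT.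
have mb0 : m (msg_reg i 1) = (tB t i)`_0 := msg 1 isT.
have mb1 : m (msg_reg i 2) = (tB t i)`_1 := msg 2 isT.
have mx : m (msg_reg i 3) = tx t i := msg 3 isT.
rewrite mz mb0 mb1 mx m0 /arith_sem -qy.
have test : (orc i (qpath dom s i + omega i) - orc i (qpath dom s i)) / omega i
     * (tx t i - qpath dom s i) + orc i (qpath dom s i)
     - (orc i.+1 (qpath dom s i.+1) * (qpath dom s i.+1 - tz t i)
        + ((tB t i)`_0 + (tB t i)`_1 * tx t i)) == 0 = round_test i.
  have h := hash_omega (tf t i) (tx t i) ir yL; rewrite -qy in h.
  by rewrite subr_eq0 /round_test poly_2E h.
rewrite test [step _ _ (block [::])]/=.
rewrite /verifier_inv forall_ordS -mb; case: (round_test i); split.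
- by repeat verifier_lookup.
- move=> j jr; rewrite !write_neq ?jW // ?mm //.
  by case/andP: jr; rewrite lt0n.
- by repeat verifier_lookup; rewrite andbT.
- by repeat verifier_lookup.
- move=> j jr; rewrite !write_neq ?jW // ?mm //.
  by case/andP: jr; rewrite lt0n.
- by repeat verifier_lookup; rewrite andbF oner_eq0.
Transparent write work_reg msg_reg.
Qed.

Lemma verifier_correct : exists2 n', (n' <= 17 * r + 6)%N &
  exists2 m', exec_query verifier t s = State m' [::] [::] n' (3 * r + 1)
    & (m' 0 == 0) = query_accepts t s.
Proof.
have sil : silent verifier by rewrite /verifier /= silent_loop.
rewrite /exec_query.
have [n' le ->] := exec_silent orc (nth 0 (s :: messages t)) [::] [::] 0 0 sil.
exists n'.
  rewrite (leq_trans le) // /verifier /= !addn0.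
  have : (cost (loop verifier_round r) <= r * 17)%N by apply: cost_loop.
  by lia.
exists (step orc (nth 0 (s :: messages t)) verifier).
  congr State; rewrite /verifier /= (@queries_loop _ _ _ 3) //; lia.
rewrite /verifier step_block step_const step_block.
set m1 := step _ _ (loop _ _).
have [m10 m1m m1b] : verifier_inv r m1.
  apply: (@step_loop _ _ _ verifier_inv); first by move=> j mj; apply: verifier_roundP.
  split.
  - by rewrite write_neq // work_reg_neq0.
  - by move=> j jr; rewrite write_neq // /work_reg; lia.
  - by rewrite write_same eqxx; apply/esym/forallP => -[].
clearbody m1; rewrite step_block step_query.
have msgC : m1 (4 * r + 1)%N = tC t.
  rewrite m1m; last by lia.
  rewrite addn1 /= /messages nth_cat (@size_flatten_blocks _ _ 4) // mulnC ltnn.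
  by rewrite mulnC subnn.
have ne1 a : (4 * r + 1)%N != work_reg r a by rewrite /work_reg; lia.
Opaque write work_reg.
rewrite step_block step_arith; repeat verifier_lookup.
rewrite write_neq //.
rewrite step_block step_ifzero step_nop step_const; repeat verifier_lookup.
rewrite step_block step_ifzero !step_const [step _ _ (block [::])]/=.
rewrite msgC m10 /arith_sem subr_eq0 -/(orc r).
have -> : query_accepts t s =
    (m1 (work_reg r 0) == 0) && (orc r (qpath dom s r) == tC t) by rewrite m1b.
case: (_ == tC t); repeat verifier_lookup.
- by rewrite andbT; case: ifP => e; rewrite write_same ?eqxx ?oner_eq0.
- by rewrite andbF oner_eq0 write_same oner_eq0.
Transparent write work_reg.
Qed.

End Verifier.

(** * The prover program *)

Section Points.

Context (F : finFieldType).
Implicit Types (D : {set F}).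

(** Listed in the order of [codom], so that register arrays match the transmitted tables. *)
Definition points D : seq F := [seq val u | u <- enum {: {x : F | x \in D}}].

Definition point D (j : nat) : F := nth 0 (points D) j.

Lemma size_points D : size (points D) = #|D|.
Proof. by rewrite size_map -cardE card_word_dom. Qed.

Lemma uniq_points D : uniq (points D).
Proof. by rewrite map_inj_uniq ?enum_uniq //; apply: val_inj. Qed.

Lemma mem_points D x : (x \in points D) = (x \in D).
Proof.
apply/mapP/idP => [[u _ ->]|xD]; first exact: (valP u).
by exists (Sub x xD); rewrite ?mem_enum.
Qed.

Lemma point_in D j : (j < #|D|)%N -> point D j \in D.
Proof. by move=> jD; rewrite -mem_points mem_nth ?size_points. Qed.

Lemma point_eq D j j' : (j < #|D|)%N -> (j' < #|D|)%N ->
  (point D j == point D j') = (j == j').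
Proof. by move=> jD jD'; rewrite nth_uniq ?size_points ?uniq_points. Qed.

Lemma point_index D x : x \in D ->
  (index x (points D) < #|D|)%N /\ point D (index x (points D)) = x.
Proof.
rewrite -mem_points -size_points -index_mem => h; split=> //.
by rewrite /point nth_index -?index_mem.
Qed.

Lemma codom_points D (f : word D) :
  codom f = [seq ev f (point D j) | j <- iota 0 #|D|].
Proof.
have -> : codom f = [seq ev f x | x <- points D].
  by rewrite /points -map_comp; apply: eq_map => u /=; rewrite ev_val.
rewrite -[in LHS](mkseq_nth 0 (points D)) size_points /mkseq -map_comp.
exact: eq_map.
Qed.

Lemma big_points (T : Type) (idx : T) (op : Monoid.com_law idx) D
    (P : pred F) (G : F -> T) :
  \big[op/idx]_(x in D | P x) G x
  = \big[op/idx]_(0 <= j < #|D| | P (point D j)) G (point D j).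
Proof.
rewrite -size_points -(big_nth 0 P G) -big_enum_cond /=.
apply: perm_big; apply: uniq_perm; rewrite ?enum_uniq ?uniq_points // => x.
by rewrite mem_enum mem_points.
Qed.

(** The barycentric weight: for s in [D], the leading coefficient of [lagr D s]. It depends on the
    domain only, so a program may hold it as a constant. *)
Definition kappa D (s : F) : F := \prod_(b in D | b != s) (s - b)^-1.

Lemma kappa_neq0 D s : kappa D s != 0.
Proof.
by apply/prodf_neq0 => b /andP[_ bs]; rewrite invr_eq0 subr_eq0 eq_sym.
Qed.

Lemma lagr_kappa D s :
  lagr D s = kappa D s *: \prod_(b in D | b != s) ('X - b%:P).
Proof.
rewrite /lagr -scaler_prod; apply: eq_bigl => b.
by rewrite in_setD1 andbC.
Qed.

(** Deleting the factor of index j leaves a prefix and a suffix product, so all Lagrange values at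
    [z] together take linearly many operations. *)
Lemma lagr_horner D j z : (j < #|D|)%N ->
  (lagr D (point D j)).[z] = kappa D (point D j)
    * \prod_(0 <= b < j) (z - point D b)
    * \prod_(j.+1 <= b < #|D|) (z - point D b).
Proof.
move=> jD; rewrite lagr_kappa hornerZ -mulrA; congr (_ * _).
rewrite horner_prod big_points /=.
under eq_bigr do rewrite hornerXsubC.
rewrite (@big_cat_nat _ _ _ j) //=; last exact: ltnW.
rewrite big_nat_cond [X in X * _ = _](_ : _ = \prod_(0 <= b < j) (z - point D b)); last first.
  rewrite [RHS]big_nat; apply: eq_bigl => b.
  case: (ltnP b j) => bj; rewrite ?andbF //= point_eq ?(ltn_trans bj) //.
  by rewrite ltn_eqF.
congr (_ * _); rewrite big_ltn_cond // eqxx /=.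
rewrite big_nat_cond [RHS]big_nat; apply: eq_bigl => b.
case/boolP: (j < b < #|D|)%N => //= /andP[jb bD].
by rewrite point_eq // gtn_eqF.
Qed.

(** For s in [D], [lagr D s] has degree |D| - 1 and leading coefficient [kappa D s]. *)
Lemma coef_interp_top D (f : F -> F) :
  (interp D f)`_#|D|.-1 = \sum_(s in D) kappa D s * f s.
Proof.
rewrite /interp coef_sum; apply: eq_bigr => s sD.
pose p := \prod_(b in D | b != s) ('X - b%:P).
rewrite coefZ lagr_kappa coefZ -/p.
have pm : p \is monic by apply: monic_prod => b _; apply: monicXsubC.
have sp : size p = #|D|.
  have -> : p = \prod_(b in D :\ s) ('X - b%:P).
    by apply: eq_bigl => b; rewrite in_setD1 andbC.
  rewrite -big_enum /= size_prod_XsubC -cardE.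
  by rewrite [RHS](cardsD1 s) sD.
by rewrite -sp; have /monicP := pm; rewrite lead_coefE => ->; rewrite mulr1 mulrC.
Qed.

(* The quotient polynomial has degree < #|D| - 1, so that its values satisfy a
   linear relation, which determines the value at z. *)
Lemma quotient_at D (g : word D) z : z \in D ->
  let w := Defs.quotient g z (interp D (ev g)).[z] in
  ev w z = - (kappa D z)^-1 * \sum_(s in D | s != z) kappa D s * ev w s.
Proof.
move=> zD w.
have top : (interp D (ev w))`_#|D|.-1 = 0.
  rewrite nth_default //; apply: leq_trans (size_interp_quotient _ _) _.
  have := size_interp D (ev g).
  by case: (size _) #|D| => [|a] [|b].
move: top; rewrite coef_interp_top (bigD1 z) //= => /eqP.
rewrite addr_eq0 => /eqP e; rewrite mulNr -mulrN -e mulKf //.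
exact: kappa_neq0.
Qed.

Lemma quotient_off D (g : word D) z b y : y \in D -> y != z ->
  ev (Defs.quotient g z b) y = (ev g y - b) / (y - z).
Proof. by move=> yD yz; rewrite [LHS]/ev insubT ffunE /= yz. Qed.

End Points.

(* Register layout of the prover: entry j of array a. The arrays are
   1: f^(i), then f^(i+1); 2, 3: coefficients of the hash polynomials;
   4: z - s; 5, 6: prefix and suffix products of array 4; 8: z; 9: x;
   10, 11: coefficients of B_z; 12: B_z(x); 13: sum of the kappa_s f^(i+1)(s);
   14, 15: scratch. *)
Definition ad (a j : nat) : nat := (16 * j + a)%N.

Lemma ad_neq_array a b j j' : (a < 16)%N -> (b < 16)%N -> a != b -> ad a j != ad b j'.
Proof. by rewrite /ad; lia. Qed.

Lemma ad_neq_index a j j' : j != j' -> ad a j != ad a j'.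
Proof. by rewrite /ad; lia. Qed.

Definition frame (F : Type) (W : seq nat) (m m' : nat -> F) : Prop :=
  forall a j, (a < 16)%N -> a \notin W -> m' (ad a j) = m (ad a j).

Ltac ad_lookup := first
  [ rewrite write_same
  | rewrite write_neq; [|exact: ad_neq_array]
  | rewrite write_neq; [|exact: ad_neq_index] ].

Ltac ad_frame := let a := fresh in let j := fresh in let a16 := fresh in
  let nW := fresh in move=> a j a16 nW; move: (nW); repeat (rewrite in_cons negb_or => /andP[?]); move=> _;
  repeat ad_lookup.

(** * Linear-time loops of one prover round *)

Section Phases.

Variables (F : fieldType) (orc : nat -> F -> F).
Implicit Types (m : nat -> F).

(** The coefficients of a hash polynomial are fixed linear combinations of the two values of f on
    the fibre, whose positions are [e0 j] and [e1 j]. *)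
Definition combine_body (e0 e1 : nat -> nat) (c00 c01 c10 c11 s : nat -> F)
    (j : nat) : prog F :=
  block [:: Const (ad 14 0) (c00 j); Arith F (ad 14 0) Mul (ad 14 0) (ad 1 (e0 j));
    Const (ad 15 0) (c01 j); Arith F (ad 15 0) Mul (ad 15 0) (ad 1 (e1 j));
    Arith F (ad 2 j) Add (ad 14 0) (ad 15 0);
    Const (ad 14 0) (c10 j); Arith F (ad 14 0) Mul (ad 14 0) (ad 1 (e0 j));
    Const (ad 15 0) (c11 j); Arith F (ad 15 0) Mul (ad 15 0) (ad 1 (e1 j));
    Arith F (ad 3 j) Add (ad 14 0) (ad 15 0);
    Const (ad 14 0) (s j); Arith F (ad 4 j) Defs.Sub (ad 8 0) (ad 14 0)].

Opaque write ad.

Lemma combineP e0 e1 c00 c01 c10 c11 s N m :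
  let m' := step orc m (loop (combine_body e0 e1 c00 c01 c10 c11 s) N) in
  frame [:: 2; 3; 4; 14; 15]%N m m' /\
  forall j, (j < N)%N ->
  [/\ m' (ad 2 j) = c00 j * m (ad 1 (e0 j)) + c01 j * m (ad 1 (e1 j)),
      m' (ad 3 j) = c10 j * m (ad 1 (e0 j)) + c11 j * m (ad 1 (e1 j))
    & m' (ad 4 j) = m (ad 8 0) - s j].
Proof.
pose I j mj := frame [:: 2; 3; 4; 14; 15]%N m mj /\
  forall j', (j' < j)%N ->
  [/\ mj (ad 2 j') = c00 j' * m (ad 1 (e0 j')) + c01 j' * m (ad 1 (e1 j')),
      mj (ad 3 j') = c10 j' * m (ad 1 (e0 j')) + c11 j' * m (ad 1 (e1 j'))
    & mj (ad 4 j') = m (ad 8 0) - s j'].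
apply: (@step_loop _ _ _ I); last by split.
move=> j mj _ [fr IH]; rewrite /combine_body.
do 12 step_once ad_lookup; rewrite [step _ _ (block [::])]/= !fr //.
split; first by ad_frame; apply: fr.
move=> j'; rewrite ltnS leq_eqVlt => /orP[/eqP->|lt].
  by split; repeat ad_lookup.
have [e2 e3 e4] := IH j' lt.
have ne : j' != j by rewrite ltn_eqF.
by split; repeat ad_lookup.
Qed.

Definition prefix_prog (N : nat) : prog F :=
  Then (Const (ad 5 0) 1%R)
    (loop (fun j => Arith F (ad 5 j.+1) Mul (ad 5 j) (ad 4 j)) N).

Lemma prefixP N m :
  let m' := step orc m (prefix_prog N) in
  frame [:: 5]%N m m' /\
  forall j, (j <= N)%N -> m' (ad 5 j) = \prod_(0 <= b < j) m (ad 4 b).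
Proof.
pose I j mj := frame [:: 5]%N m mj /\
  forall j', (j' <= j)%N -> mj (ad 5 j') = \prod_(0 <= b < j') m (ad 4 b).
apply: (@step_loop _ _ _ I) => [j mj _ [fr IH]|].
  rewrite step_arith [mj (ad 4 _)]fr // IH //; split; first by ad_frame; apply: fr.
  move=> j'; rewrite leq_eqVlt => /orP[/eqP->|lt].
    by repeat ad_lookup; rewrite big_nat_recr.
  have ne : j' != j.+1 by rewrite ltn_eqF.
  by repeat ad_lookup; apply: IH.
split; first by rewrite ?step_const; ad_frame.
by move=> j'; rewrite leqn0 => /eqP->; rewrite ?step_const; repeat ad_lookup; rewrite big_nil.
Qed.

Definition suffix_prog (N : nat) : prog F :=
  Then (Const (ad 6 N) 1%R)
    (loop (fun j => Arith F (ad 6 (N - j.+1)) Mul (ad 4 (N - j.+1)) (ad 6 (N - j))) N).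

Lemma suffixP N m :
  let m' := step orc m (suffix_prog N) in
  frame [:: 6]%N m m' /\
  forall j, (j <= N)%N -> m' (ad 6 j) = \prod_(j <= b < N) m (ad 4 b).
Proof.
pose I j mj := frame [:: 6]%N m mj /\
  forall j', (N - j <= j' <= N)%N -> mj (ad 6 j') = \prod_(j' <= b < N) m (ad 4 b).
suff [fr h] : I N (step orc m (suffix_prog N)).
  by split=> // j jN; apply: h; rewrite subnn.
apply: (@step_loop _ _ _ I) => [j mj jN [fr IH]|].
  rewrite step_arith [mj (ad 4 _)]fr // IH; last by rewrite leqnn leq_subr.
  split; first by ad_frame; apply: fr.
  move=> j' /andP[l1 l2]; case: (eqVneq j' (N - j.+1)%N) => [->|ne].
    repeat ad_lookup; rewrite [RHS]big_ltn ?subnSK //; lia.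
  by repeat ad_lookup; apply: IH; lia.
split; first by rewrite ?step_const; ad_frame.
move=> j'; rewrite subn0 -eqn_leq => /eqP<-.
by rewrite ?step_const; repeat ad_lookup; rewrite big_geq.
Qed.

Definition message_body (kap : nat -> F) (j : nat) : prog F :=
  block [:: Const (ad 14 0) (kap j); Arith F (ad 14 0) Mul (ad 14 0) (ad 5 j);
    Arith F (ad 14 0) Mul (ad 14 0) (ad 6 j.+1);
    Arith F (ad 15 0) Mul (ad 14 0) (ad 2 j);
    Arith F (ad 10 0) Add (ad 10 0) (ad 15 0);
    Arith F (ad 15 0) Mul (ad 14 0) (ad 3 j);
    Arith F (ad 11 0) Add (ad 11 0) (ad 15 0)].

Definition message_prog (kap : nat -> F) (N : nat) : prog F :=
  Then (block [:: Const (ad 10 0) 0%R; Const (ad 11 0) 0%R])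
    (loop (message_body kap) N).

Lemma messageP kap N m :
  let m' := step orc m (message_prog kap N) in
  [/\ frame [:: 10; 11; 14; 15]%N m m',
      m' (ad 10 0) = \sum_(0 <= j < N) kap j * m (ad 5 j) * m (ad 6 j.+1) * m (ad 2 j)
    & m' (ad 11 0) = \sum_(0 <= j < N) kap j * m (ad 5 j) * m (ad 6 j.+1) * m (ad 3 j)].
Proof.
pose I n mj := [/\ frame [:: 10; 11; 14; 15]%N m mj,
      mj (ad 10 0) = \sum_(0 <= j < n) kap j * m (ad 5 j) * m (ad 6 j.+1) * m (ad 2 j)
    & mj (ad 11 0) = \sum_(0 <= j < n) kap j * m (ad 5 j) * m (ad 6 j.+1) * m (ad 3 j)].
apply: (@step_loop _ _ _ I) => [j mj _ [fr e0 e1]|].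
  rewrite /message_body; do 7 step_once ad_lookup.
  rewrite [step _ _ (block [::])]/= e0 e1 !fr //.
  split; first by ad_frame; apply: fr.
    by repeat ad_lookup; rewrite big_nat_recr.
  by repeat ad_lookup; rewrite big_nat_recr.
by split; [ad_frame | repeat ad_lookup; rewrite big_nil | repeat ad_lookup; rewrite big_nil].
Qed.

(** The divisor is z - s instead of s - z, which is the same in characteristic 2. At s = z the total
    division returns 0, so this entry adds nothing to the running sum. *)
Definition divide_body (kap : nat -> F) (j : nat) : prog F :=
  block [:: Arith F (ad 14 0) Mul (ad 9 0) (ad 3 j);
    Arith F (ad 14 0) Add (ad 2 j) (ad 14 0);
    Arith F (ad 14 0) Defs.Sub (ad 14 0) (ad 12 0);
    Arith F (ad 1 j) Div (ad 14 0) (ad 4 j);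
    Const (ad 15 0) (kap j); Arith F (ad 15 0) Mul (ad 15 0) (ad 1 j);
    Arith F (ad 13 0) Add (ad 13 0) (ad 15 0)].

Definition divide_prog (kap : nat -> F) (N : nat) : prog F :=
  Then (block [:: Arith F (ad 14 0) Mul (ad 9 0) (ad 11 0);
                  Arith F (ad 12 0) Add (ad 10 0) (ad 14 0);
                  Const (ad 13 0) 0%R])
    (loop (divide_body kap) N).

Lemma divideP kap N m :
  let m' := step orc m (divide_prog kap N) in
  let h j := (m (ad 2 j) + m (ad 9 0) * m (ad 3 j)
              - (m (ad 10 0) + m (ad 9 0) * m (ad 11 0))) / m (ad 4 j) in
  [/\ frame [:: 1; 12; 13; 14; 15]%N m m',
      forall j, (j < N)%N -> m' (ad 1 j) = h j
    & m' (ad 13 0) = \sum_(0 <= j < N) kap j * h j].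
Proof.
move=> m' h; rewrite {}/m'.
pose I n mj := [/\ frame [:: 1; 12; 13; 14; 15]%N m mj,
      mj (ad 12 0) = m (ad 10 0) + m (ad 9 0) * m (ad 11 0),
      forall j, (j < n)%N -> mj (ad 1 j) = h j
    & mj (ad 13 0) = \sum_(0 <= j < n) kap j * h j].
suff [? _ ? ?] : I N (step orc m (divide_prog kap N)) by split.
apply: (@step_loop _ _ _ I) => [j mj _ [fr eb IH eT]|].
  rewrite /divide_body; do 7 step_once ad_lookup.
  rewrite [step _ _ (block [::])]/= eb eT !fr //.
  split; [by ad_frame; apply: fr | by repeat ad_lookup | |].
    move=> j'; rewrite ltnS leq_eqVlt => /orP[/eqP->|lt].
      by repeat ad_lookup.
    have ne : j' != j by rewrite ltn_eqF.
    by repeat ad_lookup; apply: IH.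
  by repeat ad_lookup; rewrite big_nat_recr.
repeat ad_lookup.
by split=> //; [ad_frame | repeat ad_lookup; rewrite big_nil].
Qed.

(** Array 4 vanishes only at s = z, where the division gave no information. The value comes from
    [quotient_at], whose sign disappears in characteristic 2. *)
Definition repair_body (kap : nat -> F) (j : nat) : prog F :=
  IfZero (ad 4 j) (block [:: Const (ad 14 0) (kap j)^-1;
                             Arith F (ad 1 j) Mul (ad 14 0) (ad 13 0)]) (Nop F).

Lemma repairP kap N m :
  let m' := step orc m (loop (repair_body kap) N) in
  forall j, (j < N)%N ->
  m' (ad 1 j) = if m (ad 4 j) == 0 then (kap j)^-1 * m (ad 13 0) else m (ad 1 j).
Proof.
pose v j := if m (ad 4 j) == 0 then (kap j)^-1 * m (ad 13 0) else m (ad 1 j).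
pose I n mj := [/\ frame [:: 1; 14]%N m mj,
    forall j, (j < n)%N -> mj (ad 1 j) = v j
  & forall j, (n <= j)%N -> mj (ad 1 j) = m (ad 1 j)].
suff [_ h _] : I N (step orc m (loop (repair_body kap) N)) by [].
apply: (@step_loop _ _ _ I) => [j mj _ [fr IH IH']|]; last by split.
rewrite /repair_body step_ifzero step_nop fr //.
case: ifP => z.
  do 2 step_once ad_lookup; rewrite [step _ _ (block [::])]/= !fr //.
  split; first by ad_frame; apply: fr.
    move=> j'; rewrite ltnS leq_eqVlt => /orP[/eqP->|lt].
      by repeat ad_lookup; rewrite /v z.
    have ne : j' != j by rewrite ltn_eqF.
    by repeat ad_lookup; apply: IH.
  move=> j' lt; have ne : j' != j by rewrite gtn_eqF.
  by repeat ad_lookup; apply: IH'; apply: ltnW.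
split=> // [j'|j' lt]; last by apply: IH'; apply: ltnW.
rewrite ltnS leq_eqVlt => /orP[/eqP->|lt]; last exact: IH.
by rewrite IH' // /v z.
Qed.

(** A move is coded as an addition to zero. *)
Definition copy_body (N j : nat) : prog F :=
  let d := ad 1 (N - j.+1) in
  block [:: Const d 0%R; Arith F d Add d (N - j.+1)].

Transparent ad.

(* The copy proceeds downwards, so that no source is overwritten. *)
Lemma copyP N m :
  let m' := step orc m (loop (copy_body N) N) in
  forall j, (j < N)%N -> m' (ad 1 j) = m j.
Proof.
pose I n mj := (forall j, (N - n <= j < N)%N -> mj (ad 1 j) = m j) /\
  (forall j, (j < ad 1 (N - n))%N -> mj j = m j).
suff [h _] : I N (step orc m (loop (copy_body N) N)).
  by move=> m' j jN; apply: h; rewrite subnn.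
apply: (@step_loop _ _ _ I) => [n mj nN [IH IH']|]; last first.
  by split=> // j; lia.
rewrite /copy_body; set d := ad 1 _; set e := (N - n.+1)%N.
have de : e != d by rewrite /d /ad; lia.
rewrite step_block step_const step_block step_arith write_same write_neq //.
rewrite [step _ _ (block [::])]/=.
split=> j jr.
  case: (eqVneq j e) => [->|ne]; first by rewrite write_same /= add0r IH' // /ad; lia.
  rewrite !write_neq; try by apply: ad_neq_index.
  by apply: IH; lia.
have jd : j != d by rewrite ltn_eqF.
by rewrite !write_neq // IH' // (ltn_trans jr) // /d /ad; lia.
Qed.

Transparent write.

End Phases.

(** * The honest prover as one program *)

Section HonestProver.

Context (F : finFieldType) (ch2 : 2%N \in [pchar F]) (k r : nat).
Variables (dom : domains ch2 k r).

Let D (i : nat) : {set F} := L dom i.+1.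
Let orc : nat -> F -> F := fun _ _ => 0.

Definition fibre (i j : nat) : {set F} :=
  [set y in L dom i | (q dom i).[y] == point (D i) j].

(** Chosen while the program is built: it affects only register indices and constants and costs
    nothing at run time. *)
Definition fibre_root (i j : nat) : F := odflt 0 [pick y in fibre i j].

Definition fibre_root' (i j : nat) : F := fibre_root i j + omega dom i.

Lemma fibre_rootP i j : (i < r)%N -> (j < #|D i|)%N ->
  fibre i j = [set fibre_root i j; fibre_root' i j] /\
  fibre_root i j != fibre_root' i j.
Proof.
move=> ir jD; have [w0 E] := omegaP dom ir.
have : fibre_root i j \in fibre i j.
  rewrite /fibre_root; case: pickP => [//|e].
  have : point (D i) j \in [set (q dom i).[x] | x in L dom i].
    by rewrite -image_q // point_in.
  case/imsetP => y yL ey.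
  by have := e y; rewrite in_set yL -/(D i) ey eqxx.
rewrite {1}/fibre in_set => /andP[yL /eqP ey].
rewrite /fibre -ey (q_fibre ir w0 E yL); split=> //.
by rewrite -{1}[fibre_root i j]addr0 (inj_eq (addrI _)) eq_sym.
Qed.

Lemma hash_poly_coefE i j (f : word (L dom i)) e : (i < r)%N -> (j < #|D i|)%N ->
  (hash_poly f (point (D i) j))`_e
  = (lagr (fibre i j) (fibre_root i j))`_e * ev f (fibre_root i j)
    + (lagr (fibre i j) (fibre_root' i j))`_e * ev f (fibre_root' i j).
Proof.
move=> ir jD; have [E ne] := fibre_rootP ir jD.
rewrite /hash_poly -/(fibre i j) /interp {1}E big_setU1 ?in_set1 // big_set1.
by rewrite coefD !coefZ mulrC [X in _ + X]mulrC.
Qed.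

Definition message_part (i : nat) : prog F :=
  let N := #|D i| in
  let index_of y := index y (points (L dom i)) in
  let c e y j := (lagr (fibre i j) (y j))`_e in
  block [:: loop (combine_body (fun j => index_of (fibre_root i j))
              (fun j => index_of (fibre_root' i j))
              (c 0 (fibre_root i)) (c 0 (fibre_root' i))
              (c 1 (fibre_root i)) (c 1 (fibre_root' i)) (point (D i))) N;
            prefix_prog F N; suffix_prog F N;
            message_prog (fun j => kappa (D i) (point (D i) j)) N]%N.

Definition oracle_part (i : nat) : prog F :=
  let N := #|D i| in let kap j := kappa (D i) (point (D i) j) in
  block [:: divide_prog kap N; loop (repair_body kap) N].

Definition round_prog (i : nat) : prog F :=
  block [:: Recv F (ad 8 0); message_part i; Send F (ad 10 0); Send F (ad 11 0);
            Recv F (ad 9 0); oracle_part i;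
            loop (fun j => Send F (ad 1 j)) #|D i|].

Definition prover_prog : prog F :=
  block [:: loop (copy_body F #|L dom 0|) #|L dom 0|; loop round_prog r;
            Send F (ad 1 (index 0 (points (L dom r))))].

Definition holds_word (i : nat) (f : word (L dom i)) (m : nat -> F) : Prop :=
  forall j, (j < #|L dom i|)%N -> m (ad 1 j) = ev f (point (L dom i) j).

Definition holds_hash (i : nat) (f : word (L dom i)) (z : F) (m : nat -> F) : Prop :=
  [/\ forall j, (j < #|D i|)%N ->
        [/\ m (ad 2 j) = (hash_poly f (point (D i) j))`_0,
            m (ad 3 j) = (hash_poly f (point (D i) j))`_1
          & m (ad 4 j) = z - point (D i) j],
      m (ad 10 0) = (honestB f z : {poly F})`_0
    & m (ad 11 0) = (honestB f z : {poly F})`_1].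

Lemma honestB_coef i (f : word (L dom i)) z e : (i < r)%N ->
  (honestB f z : {poly F})`_e = \sum_(0 <= j < #|D i|)
    (lagr (D i) (point (D i) j)).[z] * (hash_poly f (point (D i) j))`_e.
Proof.
move=> ir; rewrite /honestB npolypK; last first.
  apply: leq_trans (size_sum _ _ _) _; apply/bigmax_leqP => s _.
  by rewrite (leq_trans (size_scale_leq _ _)) ?size_hash_poly.
rewrite coef_sum; under eq_bigr do rewrite coefZ.
rewrite -(@big_points F F 0 +%R (D i) xpredT
  (fun s => (lagr (D i) s).[z] * (hash_poly f s)`_e)).
by apply: eq_bigl => s; rewrite andbT.
Qed.

Opaque write ad.

Lemma message_partP i (f : word (L dom i)) m : (i < r)%N ->
  holds_word f m ->
  holds_hash f (m (ad 8 0)) (step orc m (message_part i)).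
Proof.
move=> ir hf; rewrite /message_part !step_block.
set m1 := step _ m _; set m2 := step _ m1 _; set m3 := step _ m2 _.
set m4 := step _ m3 _; rewrite [step _ _ (block [::])]/=.
have [_ v1] : frame _ m m1 /\ _ := combineP _ _ _ _ _ _ _ _ _ _.
have [fr2 v2] : frame _ m1 m2 /\ _ := prefixP orc #|D i| m1.
have [fr3 v3] : frame _ m2 m3 /\ _ := suffixP orc #|D i| m2.
have [fr4 v4 v4'] : [/\ frame _ m3 m4, _ & _] :=
  messageP orc (fun j => kappa (D i) (point (D i) j)) #|D i| m3.
rewrite -/m1 in v1; rewrite -/m2 in v2; rewrite -/m3 in v3.
rewrite -/m4 in v4; rewrite -/m4 in v4'.
have {}v1 j : (j < #|D i|)%N -> [/\ m1 (ad 2 j) = (hash_poly f (point (D i) j))`_0,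
    m1 (ad 3 j) = (hash_poly f (point (D i) j))`_1
  & m1 (ad 4 j) = m (ad 8 0) - point (D i) j].
  move=> jD; have [-> -> ->] := v1 j jD.
  have [E _] := fibre_rootP ir jD.
  have rL : fibre_root i j \in L dom i.
    by have : fibre_root i j \in fibre i j;
      [rewrite E in_set2 eqxx | rewrite in_set => /andP[]].
  have rL' : fibre_root' i j \in L dom i.
    by have : fibre_root' i j \in fibre i j;
      [rewrite E in_set2 eqxx orbT | rewrite in_set => /andP[]].
  have [l0 e0] := point_index rL; have [l1 e1] := point_index rL'.
  by rewrite !hash_poly_coefE // !hf // e0 e1.
have w j e : (j < #|D i|)%N -> e \in [:: 2; 3; 4]%N -> m3 (ad e j) = m1 (ad e j).
  by move=> _; rewrite !inE => /or3P[] /eqP->; rewrite fr3 // fr2.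
(* Weight, prefix product and suffix product multiply to the Lagrange value at z, so the sums of the
   message loop become the coefficients of [honestB]. *)
have lam j : (j < #|D i|)%N -> kappa (D i) (point (D i) j) * m3 (ad 5 j) * m3 (ad 6 j.+1)
    = (lagr (D i) (point (D i) j)).[m (ad 8 0)].
  move=> jD; rewrite lagr_horner // v3 // [m3 (ad 5 j)]fr3 // v2; last exact: ltnW.
  congr (_ * _ * _).
    rewrite big_nat [RHS]big_nat; apply: eq_bigr => b /andP[_ bj].
    by have [_ _ ->] := v1 b (ltn_trans bj jD).
  rewrite big_nat [RHS]big_nat; apply: eq_bigr => b /andP[_ bD].
  by rewrite fr2 //; have [_ _ ->] := v1 b bD.
split.
- move=> j jD; have [e2 e3 e4] := v1 j jD.
  by rewrite !fr4 // !w // e2 e3 e4.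
- rewrite v4 honestB_coef // big_nat [RHS]big_nat; apply: eq_bigr => j /andP[_ jD].
  by rewrite lam // w //; have [-> _ _] := v1 j jD.
- rewrite v4' honestB_coef // big_nat [RHS]big_nat; apply: eq_bigr => j /andP[_ jD].
  by rewrite lam // w //; have [_ -> _] := v1 j jD.
Qed.

Lemma oracle_partP i (f : word (L dom i)) z m : (i < r)%N ->
  holds_hash f z m ->
  let x := m (ad 9 0) in
  holds_word (Defs.quotient (hash x f) z (honestB f z).[x])
    (step orc m (oracle_part i)).
Proof.
move=> ir [hA hB0 hB1] x j jD; rewrite /oracle_part !step_block.
set m1 := step _ m _; set m2 := step _ m1 _; rewrite [step _ _ (block [::])]/=.
have [fr1 v1 v1'] : [/\ frame _ m m1, _ & _] :=
  divideP orc (fun j => kappa (D i) (point (D i) j)) #|D i| m.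
have v2 : forall j, (j < _)%N -> m2 (ad 1 j) = _ :=
  @repairP F orc (fun j => kappa (D i) (point (D i) j)) #|D i| m1.
rewrite -/m1 in v1; rewrite -/m1 in v1'; rewrite -/m2 in v2.
have [e2 e3 e4] := hA j jD.
pose g := hash x f.
have eb : (honestB f z).[x] = (interp (D i) (ev g)).[z] by apply: honestB_spec.
have hval b : (b < #|D i|)%N ->
    (m (ad 2 b) + m (ad 9 0) * m (ad 3 b)
     - (m (ad 10 0) + m (ad 9 0) * m (ad 11 0))) / m (ad 4 b)
    = (ev g (point (D i) b) - (honestB f z).[x]) / (point (D i) b - z).
  move=> bD; have [-> -> ->] := hA b bD.
  rewrite hB0 hB1 poly_2E [_ * x]mulrC hash_poly_coef // ev_hash ?point_in //.
  by rewrite -[z - _](opp_ch2 ch2) opprB.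
rewrite v2 // fr1 // e4 subr_eq0.
case: eqVneq => [ez|nz]; last first.
  by rewrite v1 // hval // quotient_off ?point_in // eq_sym.
have zD : z \in D i by rewrite ez point_in.
rewrite -ez eb quotient_at // -eb v1' [- _^-1](opp_ch2 ch2); congr (_ * _).
(* The summand at s = z is 0 by the division convention, so the full sum equals the sum over the
   other points in [quotient_at]. *)
rewrite (@big_points F F 0 +%R) [RHS]big_mkcond /= big_nat [RHS]big_nat.
apply: eq_bigr => b /andP[_ bD]; rewrite hval // eb.
case: eqVneq => [->|nz] /=; first by rewrite subrr invr0 !mulr0.
by rewrite quotient_off ?point_in.
Qed.

Transparent write ad.

Lemma exec_block p s (st : state F) :
  exec orc (block (p :: s)) st = exec orc (block s) (exec orc p st).
Proof. by case: st. Qed.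

Lemma exec_loopS body N (st : state F) :
  exec orc (loop body N.+1) st = exec orc (body N) (exec orc (loop body N) st).
Proof. by case: st. Qed.

Lemma exec_send_loop N m ib tr n nq :
  exec orc (loop (fun j => Send F (ad 1 j)) N) (State m ib tr n nq)
  = State m ib (tr ++ [seq Sent (m (ad 1 j)) | j <- iota 0 N]) n nq.
Proof.
elim: N => [|N IH]; first by rewrite cats0.
by rewrite exec_loopS IH -(addn1 N) iotaD map_cat catA cats1.
Qed.

Lemma cost_message_part i : (cost (message_part i) <= 21 * #|D i| + 4)%N.
Proof.
rewrite /message_part /prefix_prog /suffix_prog /message_prog /= addn0.
set l1 := loop _ _; set l2 := loop _ _; set l3 := loop _ _; set l4 := loop _ _.
have c1 : (cost l1 <= #|D i| * 12)%N by apply: cost_loop.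
have c2 : (cost l2 <= #|D i| * 1)%N by apply: cost_loop.
have c3 : (cost l3 <= #|D i| * 1)%N by apply: cost_loop.
have c4 : (cost l4 <= #|D i| * 7)%N by apply: cost_loop.
move: c1 c2 c3 c4; move: (cost l1) (cost l2) (cost l3) (cost l4) #|D i|.
by clear; lia.
Qed.

Lemma cost_oracle_part i : (cost (oracle_part i) <= 10 * #|D i| + 3)%N.
Proof.
rewrite /oracle_part /divide_prog /= addn0.
set l1 := loop _ _; set l2 := loop _ _.
have c1 : (cost l1 <= #|D i| * 7)%N by apply: cost_loop.
have c2 : (cost l2 <= #|D i| * 3)%N by apply: cost_loop.
move: c1 c2; move: (cost l1) (cost l2) #|D i|.
by clear; lia.
Qed.

Lemma silent_message_part i : silent (message_part i).
Proof. by rewrite /message_part /= !silent_loop. Qed.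

Lemma silent_oracle_part i : silent (oracle_part i).
Proof. by rewrite /oracle_part /= !silent_loop. Qed.

Lemma queries_message_part i : queries_of (message_part i) = 0%N.
Proof. by rewrite /message_part /= !(@queries_loop _ _ _ 0) ?muln0. Qed.

Lemma queries_oracle_part i : queries_of (oracle_part i) = 0%N.
Proof. by rewrite /oracle_part /= !(@queries_loop _ _ _ 0) ?muln0. Qed.

Lemma holds_word_write i (f : word (L dom i)) m a v : (a < 16)%N -> a != 1%N ->
  holds_word f m -> holds_word f (write m (ad a 0) v).
Proof. by move=> a16 a1 h j jD; rewrite write_neq ?h // ad_neq_array // eq_sym. Qed.

Lemma round_progP i (f : word (L dom i)) m z x ib tr n : (i < r)%N ->
  holds_word f m ->
  let f' := Defs.quotient (hash x f) z (honestB f z).[x] in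
  exists m' n', [/\
    exec orc (round_prog i) (State m [:: z, x & ib] tr n 0)
    = State m' ib (tr ++ [:: Received z; Sent (honestB f z : {poly F})`_0;
        Sent (honestB f z : {poly F})`_1; Received x]
        ++ [seq Sent a | a <- codom f']) n' 0,
    holds_word f' m' & (n' <= n + 38 * #|D i|)%N].
Proof.
move=> ir hf f'; rewrite /round_prog; do 7 rewrite exec_block.
set m0 := write m (ad 8 0) z.
have -> : exec orc (Recv F (ad 8 0)) (State m [:: z, x & ib] tr n 0)
  = State m0 (x :: ib) (rcons tr (Received z)) n 0 by [].
have [n1 l1 ->] := exec_silent orc m0 (x :: ib) (rcons tr (Received z)) n 0
  (silent_message_part i).
rewrite queries_message_part.
set m1 := step orc m0 _.
have h1 : holds_hash f z m1.
  have := message_partP ir (@holds_word_write i f m 8 z isT isT hf).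
  by rewrite write_same.
set st := exec orc (Recv F (ad 9 0)) _.
have [hA hB0 hB1] := h1.
have -> : st = State (write m1 (ad 9 0) x) ib
    (tr ++ [:: Received z; Sent (honestB f z : {poly F})`_0;
        Sent (honestB f z : {poly F})`_1; Received x]) n1 0.
  by rewrite /st -hB0 -hB1 /= -!cats1 -!catA.
set m2 := write m1 _ x.
have h2 : holds_hash f z m2.
  split; rewrite /m2 ?write_neq ?ad_neq_array // => j jD.
  by have := hA j jD; rewrite !write_neq ?ad_neq_array.
have [n2 l2 ->] := exec_silent orc m2 ib (tr ++ [:: Received z;
  Sent (honestB f z : {poly F})`_0; Sent (honestB f z : {poly F})`_1; Received x])
  n1 0 (silent_oracle_part i).
rewrite queries_oracle_part exec_send_loop.
set m3 := step orc m2 _.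
have h3 : holds_word f' m3.
  by have := oracle_partP ir h2; rewrite /m2 write_same.
exists m3, n2; split=> //.
  rewrite [LHS]/= -catA; congr (State _ _ (_ ++ (_ ++ _)) _ _).
  rewrite codom_points -map_comp; apply/eq_in_map => j.
  by rewrite mem_iota add0n => /andP[_ jD] /=; rewrite h3.
(* A nonempty domain of size N absorbs the additive costs 4 and 3 into 7 N, and 21 + 10 + 7 = 38. *)
have N0 : (0 < #|D i|)%N by apply/card_gt0P; exists 0; apply: L_0.
move: l1 l2 N0 (cost_message_part i) (cost_oracle_part i).
move: (cost _) (cost _) #|D i|; clear; lia.
Qed.

Variables (f0 : word (L dom 0)) (c : coins F r).

Definition round_events (i : nat) : seq (event F) :=
  let t := run (honest f0) f0 c in
  [:: Received (tz t i); Sent (tB t i)`_0; Sent (tB t i)`_1; Received (tx t i)]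
  ++ [seq Sent a | a <- codom (tf t i.+1)].

Lemma prover_progP :
  let st := exec_prover prover_prog f0 c in
  trace st = honest_trace f0 c /\ (nops st <= 40 * #|L dom 0|)%N.
Proof.
rewrite /exec_prover /prover_prog; do 3 rewrite exec_block.
set ib0 := flatten _; set n0 := #|L dom 0|; set lp := loop (copy_body F _) _.
have sil : silent lp by apply: silent_loop.
have [n1 l1 ->] := exec_silent orc (nth 0 (codom f0)) ib0 [::] 0 0 sil.
have -> : queries_of lp = 0%N by rewrite (@queries_loop _ _ _ 0) // muln0.
set m1 := step orc _ lp.
have h1 : holds_word f0 m1.
  move=> j jD; rewrite /m1 copyP // codom_points (nth_map 0%N) ?size_iota //.
  by rewrite nth_iota.
have c1 : (n1 + 38 * n0 <= 40 * n0)%N.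
  have : (cost lp <= n0 * 2)%N by apply: cost_loop.
  by move: l1; move: (cost lp) (n0); clear; lia.
(* The domain halves in each round, so the reserve 38 |L^(i)| pays 38 |L^(i+1)| for the round and
   leaves the next reserve. The initial copy accounts for the other 2 n operations. *)
have main i : (i <= r)%N -> exists m n, [/\
    exec orc (loop round_prog i) (State m1 ib0 [::] n1 0)
    = State m (flatten [seq [:: zx.1; zx.2] | zx <- drop i c])
        (flatten [seq round_events j | j <- iota 0 i]) n 0,
    holds_word (honestf f0 c i) m & (n + 38 * #|L dom i| <= 40 * n0)%N].
  elim: i => [_|i IH ir]; first by exists m1, n1; rewrite drop0.
  have [m [n [e h le]]] := IH (ltnW ir).
  have ed : flatten [seq [:: zx.1; zx.2] | zx <- drop i c] = [:: (nth (0, 0) c i).1,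
      (nth (0, 0) c i).2 & flatten [seq [:: zx.1; zx.2] | zx <- drop i.+1 c]].
    by rewrite (drop_nth (0, 0)) ?size_tuple.
  have [m' [n' [e' h' le']]] := @round_progP i (honestf f0 c i) m
    (nth (0, 0) c i).1 (nth (0, 0) c i).2
    (flatten [seq [:: zx.1; zx.2] | zx <- drop i.+1 c])
    (flatten [seq round_events j | j <- iota 0 i]) n ir h.
  exists m', n'; rewrite -honestfS in h' e'; split=> //.
    rewrite exec_loopS e ed e'; congr (State _ _ _ _ _).
    rewrite -[in iota 0 i.+1](addn1 i) iotaD map_cat flatten_cat; congr (_ ++ _).
    transitivity (round_events i); last by rewrite -[LHS]cats0.
    by rewrite /round_events tf_honest tB_honest.
  have : #|L dom i| = (2 * #|L dom i.+1|)%N.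
    rewrite !card_L //; last exact: ltnW.
    by rewrite -expnS subnSK // (leq_trans ir) // (rounds_le_dim dom).
  move: le le'; rewrite /D; move: #|L dom i| #|L dom i.+1|; clear.
  by lia.
have [m [n [-> h le]]] := main r (leqnn r).
split; last by move: le => /=; move: (n0) #|L dom r|; clear; lia.
rewrite /= /honest_trace -cats1; congr (_ ++ [:: Sent _]).
have [l e] := point_index (L_0 dom r).
by rewrite h // e.
Qed.

End HonestProver.

(** * Complexity, completeness and soundness combined *)

Theorem mainTheorem8 (R : realType) :
  (* prover complexity *)
  (exists c : nat,
     forall (F : finFieldType) (ch2 : 2%N \in [pchar F]) (k r : nat)
            (dom : domains ch2 k r),
     exists p : prog F,
     forall (f0 : word (L dom 0)) (zx : coins F r),
       let st := exec_prover p f0 zx in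
       trace st = honest_trace f0 zx /\ (nops st <= c * #|L dom 0|)%N)
  /\
  (* verifier, query and communication complexity *)
  (exists c : nat,
     forall (F : finFieldType) (ch2 : 2%N \in [pchar F]) (k r : nat)
            (dom : domains ch2 k r),
     (1 < #|L dom 0|)%N ->
     let logn : R := log2 #|L dom 0|%:R in
     exists p : prog F,
     forall (t : transcript dom) (s : F), s \in L dom 0 ->
       let st := exec_query p t s in
       [/\ (reg st 0 == 0) = query_accepts t s,
           (nops st)%:R <= c%:R * logn,
           (nqueries st)%:R <= c%:R * logn
         & (communication t (nqueries st))%:R <= c%:R * logn])
  /\
  (forall (F : finFieldType) (ch2 : 2%N \in [pchar F]) (k r : nat)
          (dom : domains ch2 k r) (f0 : word (L dom 0)) (l : nat),
     let d0 := (3 * 2 ^ r - 2)%N in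
     let logn : R := log2 #|L dom 0|%:R in
     (* completeness *)
     (f0 \in RS (L dom 0) d0 ->
      Pr R [pred cs : coins F r * queries dom l |
              accepts (run (honest f0) f0 cs.1) cs.2] = 1)
     /\
     (* soundness *)
     (forall eps delta : R, 0 < eps -> 0 < delta ->
      let dstar := delta - 2 * r%:R * eps in
      let Lstar := listsize (L dom 0) d0 dstar in
      let nustar := 2 * Lstar%:R * ((d0%:R / #|F|%:R + eps) `^ (3^-1))
                    + 4 / (eps ^+ 2 * #|F|%:R) in
      let errQ := (1 - dstar + logn * eps) ^+ l in
      delta < codedist R f0 (RS (L dom 0) d0) ->
      (forall P : prover dom,
         Pr R [pred c : coins F r |
                 errQ < Pr R [pred s : queries dom l | accepts (run P f0 c) s]]
         <= r%:R * nustar)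
      /\ r%:R * nustar <= logn * nustar
      /\ (forall P : prover dom,
            Pr R [pred cs : coins F r * queries dom l |
                    accepts (run P f0 cs.1) cs.2]
            <= logn * nustar + errQ))).
Proof.
split; last split.
- exists 40%N => F ch2 k r dom; exists (prover_prog dom) => f0 zx.
  exact: prover_progP.
(* The largest of the three counts is 17 r + 6, which is at most 23 k since r <= k and 1 <= k; here
   log n is k. *)
- exists 23%N => F ch2 k r dom dom1 logn; exists (verifier dom) => t s sL st.
  have [n' le' [m' e acc]] := verifier_correct t sL.
  have kE : logn = k%:R by apply: log2_card_dom.
  have k1 : (0 < k)%N by move: dom1; rewrite card_L // subn0; case: (k).
  have rk := rounds_le_dim dom.
  rewrite /st e /= kE -!natrM !ler_nat verifier_communication; split=> //; lia.
move=> F ch2 k r dom f0 l d0 logn.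
have logn_ge : r%:R <= logn.
  by rewrite /logn log2_card_dom ler_nat (rounds_le_dim dom).
split=> [f0RS|eps delta eps0 delta0 dstar Lstar nustar errQ far].
  by apply: completeness; rewrite /deg_bound subn0.
have nu0 : r%:R * nustar <= logn * nustar.
  by rewrite ler_wpM2r // /nustar nustar_ge0.
split; [|split=> //] => P; first exact: commit_soundness.
apply: (@le_trans _ _ (r%:R * nustar + errQ)); last by rewrite lerD2r.
exact: total_soundness.
Qed.
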